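(* Let $A$ be a finite lattice. The following conditions are equivalent: (i) $A$ is amenable; (ii) $A\otimes B$ is a lattice, for every lattice $B$ with zero; (iii) $A$, regarded as a join-semilattice, is sharply transferable; (iv) $A\otimes F(3)$ is a lattice, where $F(3)$ is the free lattice on three generators; (v) $A$ satisfies the condition $(\mathrm{T}_\vee)$.
   Context: Tensor product. For lattices $A$, $B$ with least elements $0$, put $\bot_{A,B}=(A\times\{0\})\cup(\{0\}\times B)$. A bi-ideal of $A\times B$ is a subset $I\subseteq A\times B$ which is a down-set (for the componentwise order), contains $\bot_{A,B}$, and is closed under lateral joins: $(a,b_0),(a,b_1)\in I$ implies $(a,b_0\vee b_1)\in I$, and $(a_0,b),(a_1,b)\in I$ implies $(a_0\vee a_1,b)\in I$. Ordered by inclusion, the bi-ideals form an algebraic lattice $A\,\bar\otimes\, B$. For $a\in A$, $b\in B$ the pure tensor is the bi-ideal $a\otimes b=\bot_{A,B}\cup\{(x,y)\in A\times B : x\le a,\ y\le b\}$. The tensor product $A\otimes B$ is the join-semilattice with zero of compact elements of $A\,\bar\otimes\,B$, i.e. the set of all finite joins (in $A\,\bar\otimes\,B$) of pure tensors, ordered by inclusion. ''$A\otimes B$ is a lattice'' means that this ordered set is a lattice. $A\otimes B$ is a capped tensor product if every element of $A\otimes B$ is a finite union (as sets) of pure tensors. A lattice $A$ with zero is amenable if $A\otimes L$ is a capped tensor product for every lattice $L$ with zero. Sharp transferability for join-semilattices. For a join-semilattice $T$, $\mathrm{Id}\,T$ denotes the join-semilattice of (nonempty) ideals of $T$ (down-sets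 closed under finite nonempty joins), ordered by inclusion. A join-semilattice $S$ is sharply transferable if, for every join-semilattice $T$ and every (join-semilattice) embedding $\varphi$ of $S$ into $\mathrm{Id}\,T$, there exists a (join-semilattice) embedding $\xi$ of $S$ into $T$ such that $\xi(x)\in\varphi(x)$ for all $x\in S$ and, for all $x,y\in S$, $\xi(x)\in\varphi(y)$ if and only if $x\le y$. Condition $(\mathrm{T}_\vee)$. For a finite lattice $A$, $\mathrm{J}(A)$ is the set of (nonzero) join-irreducible elements of $A$. For subsets $X,Y$ of $A$, $X\ll Y$ means that for every $x\in X$ there is $y\in Y$ with $x\le y$. A minimal pair of $A$ is a pair $(p,I)$ with $p\in\mathrm{J}(A)$, $I\subseteq\mathrm{J}(A)$, such that $p\notin I$, $p\le\bigvee I$, and for all $J\subseteq\mathrm{J}(A)$, if $J\ll I$ and $p\le\bigvee J$, then $I\subseteq J$. The finite lattice $A$ satisfies $(\mathrm{T}_\vee)$ if $\mathrm{J}(A)$ has a linear order $\trianglelefteq$ such that, for every minimal pair $(p,J)$ of $A$, $p\trianglelefteq j$ holds for every $j\in J$. *)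

(* Defs.v *)
From HB Require Import structures.
From mathcomp Require Import all_boot all_order.
From mathcomp Require Import boolp classical_sets.

Set Implicit Arguments.
Unset Strict Implicit.
Unset Printing Implicit Defensive.

Import Order.Theory.

Local Open Scope classical_set_scope.
Local Open Scope order_scope.

(* The library only provides lattices as structures, and A ⊗ B need not be    *)
(* one; this says that the partial order T happens to be a lattice.           *)
Definition is_lattice d (T : porderType d) : Prop :=
  forall x y : T,
    supremums [set x; y]%classic !=set0 /\ infimums [set x; y]%classic !=set0.

Section BiIdeal.
Context {dA dB : Order.disp_t} {A : bLatticeType dA} {B : bLatticeType dB}.

Definition bot_set : set (A * B) :=
  (([set: A] `*` [set \bot]) `|` ([set \bot] `*` [set: B]))%classic.

Definition pure_set (a : A) (b : B) : set (A * B) :=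
  (bot_set `|` [set p | p.1 <= a /\ p.2 <= b])%classic.

Record is_biideal (I : set (A * B)) : Prop := IsBiideal {
  biideal_down : forall p q : A * B, p.1 <= q.1 -> p.2 <= q.2 -> I q -> I p;
  biideal_bot : (bot_set `<=` I)%classic;
  biideal_joinr : forall a b0 b1, I (a, b0) -> I (a, b1) -> I (a, b0 `|` b1);
  biideal_joinl : forall a0 a1 b, I (a0, b) -> I (a1, b) -> I (a0 `|` a1, b)
}.

End BiIdeal.

Section ExtendedTensor.
Context {dA dB : Order.disp_t} (A : bLatticeType dA) (B : bLatticeType dB).

(* The extended tensor product; inclusion is the order inherited from set. *)
Record biideal := BiIdeal {
  biideal_set :> set (A * B);
  _ : `[< is_biideal biideal_set >]
}.

HB.instance Definition _ := [isSub for biideal_set].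
HB.instance Definition _ := [Choice of biideal by <:].
HB.instance Definition _ :=
  [SubChoice_isSubPOrder of biideal by <: with set_display].

Implicit Types I J K : biideal.

Lemma biidealP I : is_biideal I.
Proof. by case: I => I /= /asboolP. Qed.

Lemma le_biideal I J : (I <= J) = `[< (I `<=` J)%classic >].
Proof. by []. Qed.

Lemma smallest_is_biideal (X : set (A * B)) :
  is_biideal (smallest is_biideal X).
Proof.
split.
- by move=> p q le1 le2 Iq M [bM XM]; apply: (biideal_down bM le1 le2); apply: Iq.
- by move=> p botp M [bM _]; apply: (biideal_bot bM).
- by move=> a b0 b1 I0 I1 M sM; apply: (biideal_joinr sM.1); [apply: I0|apply: I1].
- by move=> a0 a1 b I0 I1 M sM; apply: (biideal_joinl sM.1); [apply: I0|apply: I1].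
Qed.

Definition biideal_gen (X : set (A * B)) : biideal :=
  BiIdeal (asboolT (smallest_is_biideal X)).

Lemma biideal_gen_le (X : set (A * B)) I :
  (biideal_gen X <= I) = `[< (X `<=` I)%classic >].
Proof.
rewrite le_biideal; apply/asboolP/asboolP => [sXI|sXI].
  exact: subset_trans (@sub_gen_smallest _ _ _) sXI.
exact: smallest_sub (biidealP I) sXI.
Qed.

Lemma bot_set_is_biideal : is_biideal (@bot_set _ _ A B).
Proof.
split => //.
- move=> [a b] [a' b'] /= lea leb [[_ /= e]|[/= e _]].
    by left; split=> //=; apply/eqP; rewrite -lex0 -e.
  by right; split=> //=; apply/eqP; rewrite -lex0 -e.
- move=> a b0 b1 [[_ /= ->]|[/= -> _]].
    by rewrite join0x.
  by move=> _; right.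
- move=> a0 a1 b [[_ /= ->]|[/= -> _]].
    by move=> _; left.
  by rewrite join0x.
Qed.

Lemma setI_is_biideal I J : is_biideal (I `&` J)%classic.
Proof.
have [bI bJ] := (biidealP I, biidealP J); split.
- move=> p q le1 le2 [Iq Jq].
  by split; [apply: biideal_down bI _ _ le1 le2 Iq
            |apply: biideal_down bJ _ _ le1 le2 Jq].
- by move=> p botp; split; [apply: (biideal_bot bI)|apply: (biideal_bot bJ)].
- by move=> a b0 b1 [I0 J0] [I1 J1]; split;
    [apply: (biideal_joinr bI)|apply: (biideal_joinr bJ)].
- by move=> a0 a1 b [I0 J0] [I1 J1]; split;
    [apply: (biideal_joinl bI)|apply: (biideal_joinl bJ)].
Qed.

Definition biideal_meet I J : biideal := BiIdeal (asboolT (setI_is_biideal I J)).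
Definition biideal_join I J : biideal := biideal_gen (I `|` J)%classic.

Lemma biideal_meetP I J K : (I <= biideal_meet J K) = (I <= J) && (I <= K).
Proof. by rewrite !le_biideal -asbool_and; apply: asbool_equiv_eq; rewrite subsetI. Qed.

Lemma biideal_joinP I J K : (biideal_join I J <= K) = (I <= K) && (J <= K).
Proof.
by rewrite biideal_gen_le !le_biideal -asbool_and; apply: asbool_equiv_eq;
  rewrite subUset.
Qed.

HB.instance Definition _ :=
  Order.POrder_MeetJoin_isLattice.Build set_display biideal
    biideal_meetP biideal_joinP.

Definition biideal0 : biideal := BiIdeal (asboolT bot_set_is_biideal).

Lemma biideal0_le I : biideal0 <= I.
Proof. by rewrite le_biideal; apply/asboolP; apply: (biideal_bot (biidealP I)). Qed.

HB.instance Definition _ :=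
  Order.hasBottom.Build set_display biideal biideal0_le.

Lemma pure_set_is_biideal (a : A) (b : B) : is_biideal (pure_set a b).
Proof.
have b0 := bot_set_is_biideal; split.
- move=> p q le1 le2 [botq|[/= qa qb]]; first by left; apply: biideal_down b0 _ _ le1 le2 botq.
  by right; split; [apply: le_trans qa|apply: le_trans qb].
- by move=> p ?; left.
- move=> x y z [[[_ /= ->]|[/= -> _ _]]|[/= xa ya]]; first by rewrite join0x.
    by left; right.
  case=> [[[_ /= ->]|[/= -> _]]|[/= _ za]]; last by right; rewrite /= leUx ya za.
    by rewrite joinx0; right.
  by left; right.
- move=> x y z [[[_ /= -> _]|[/= -> _]]|[/= xa za]]; last 2 first.
  + by rewrite join0x.
  + case=> [[[_ /= ->]|[/= -> _]]|[/= ya _]]; last by right; rewrite /= leUx xa ya.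
      by left; left.
    by rewrite joinx0; right.
  by left; left.
Qed.

Definition pure_tensor (a : A) (b : B) : biideal :=
  BiIdeal (asboolT (pure_set_is_biideal a b)).

(* The tensor product: finite joins of pure tensors, ordered by inclusion.    *)
(* The empty join is bot_set, which is also the pure tensor \bot ⊗ \bot.      *)
Record tensor := Tensor {
  tensor_biideal :> biideal;
  _ : `[< exists s : seq (A * B),
            tensor_biideal = \join_(p <- s) pure_tensor p.1 p.2 >]
}.

HB.instance Definition _ := [isSub for tensor_biideal].
HB.instance Definition _ := [Choice of tensor by <:].
HB.instance Definition _ :=
  [SubChoice_isSubPOrder of tensor by <: with set_display].

Definition capped : Prop :=
  forall I : tensor, exists s : seq (A * B),
    (I : set (A * B)) = \bigcup_(p in [set` s]) pure_tensor p.1 p.2.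

End ExtendedTensor.

Definition amenable d (A : bLatticeType d) : Prop :=
  forall (d' : Order.disp_t) (L : bLatticeType d'), capped A L.

Section Ideal.
Context {d : Order.disp_t} (T : joinSemilatticeType d).

Record is_ideal (I : set T) : Prop := IsIdeal {
  ideal_nonempty : I !=set0;
  ideal_down : forall x y : T, x <= y -> I y -> I x;
  ideal_join : forall x y : T, I x -> I y -> I (x `|` y)
}.

Record ideal := Ideal {
  ideal_set :> set T;
  _ : `[< is_ideal ideal_set >]
}.

HB.instance Definition _ := [isSub for ideal_set].
HB.instance Definition _ := [Choice of ideal by <:].
HB.instance Definition _ :=
  [SubChoice_isSubPOrder of ideal by <: with set_display].

Implicit Types I J K : ideal.

Lemma idealP I : is_ideal I.
Proof. by case: I => I /= /asboolP. Qed.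

Lemma le_ideal I J : (I <= J) = `[< (I `<=` J)%classic >].
Proof. by []. Qed.

Lemma smallest_is_ideal (X : set T) :
  X !=set0 -> is_ideal (smallest is_ideal X).
Proof.
move=> [x Xx]; split.
- by exists x => M [_]; apply.
- by move=> y z yz Iz M sM; apply: (ideal_down sM.1 yz); apply: Iz.
- by move=> y z Iy Iz M sM; apply: (ideal_join sM.1); [apply: Iy|apply: Iz].
Qed.

Lemma setU_ideal_nonempty I J : (I `|` J)%classic !=set0.
Proof. by have [x Ix] := ideal_nonempty (idealP I); exists x; left. Qed.

Definition join_ideal I J : ideal :=
  Ideal (asboolT (smallest_is_ideal (setU_ideal_nonempty I J))).

Lemma join_idealP I J K : (join_ideal I J <= K) = (I <= K) && (J <= K).
Proof.
rewrite !le_ideal -asbool_and; apply: asbool_equiv_eq; rewrite -subUset.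
split=> [sIJK|sIJK].
  exact: subset_trans (@sub_gen_smallest _ _ _) sIJK.
exact: smallest_sub (idealP K) sIJK.
Qed.

HB.instance Definition _ :=
  Order.POrder_isJoinSemilattice.Build set_display ideal join_idealP.

End Ideal.

Definition join_embedding d (S : joinSemilatticeType d)
    d' (T : joinSemilatticeType d') (f : S -> T) : Prop :=
  injective f /\ {morph f : x y / x `|` y}.

Definition sharply_transferable d (S : joinSemilatticeType d) : Prop :=
  forall (d' : Order.disp_t) (T : joinSemilatticeType d') (phi : S -> ideal T),
    join_embedding phi ->
    exists xi : S -> T,
      [/\ join_embedding xi,
          forall x : S, (phi x : set T) (xi x)
        & forall x y : S, (phi y : set T) (xi x) <-> x <= y].

Inductive lterm (X : Type) : Type :=
| LVar of X
| LMeet of lterm X & lterm X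
| LJoin of lterm X & lterm X.

HB.instance Definition _ (X : Type) := gen_eqMixin (lterm X).
HB.instance Definition _ (X : Type) := gen_choiceMixin (lterm X).

(* t <= u is derivable from the lattice axioms alone *)
Inductive lterm_le (X : Type) : lterm X -> lterm X -> Prop :=
| lle_refl t : lterm_le t t
| lle_trans u t v : lterm_le t u -> lterm_le u v -> lterm_le t v
| lle_meetl t u : lterm_le (LMeet t u) t
| lle_meetr t u : lterm_le (LMeet t u) u
| lle_meet t u v : lterm_le t u -> lterm_le t v -> lterm_le t (LMeet u v)
| lle_joinl t u : lterm_le t (LJoin t u)
| lle_joinr t u : lterm_le u (LJoin t u)
| lle_join t u v : lterm_le t v -> lterm_le u v -> lterm_le (LJoin t u) v.

Section FreeLattice.
Context (X : Type).
Local Open Scope quotient_scope.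

Definition lterm_eqv (t u : lterm X) : bool :=
  `[< lterm_le t u /\ lterm_le u t >].

Lemma lterm_eqv_equiv : equiv_class_of lterm_eqv.
Proof.
split.
- by move=> t; apply/asboolP; split; apply: lle_refl.
- by move=> t u; apply/asboolP/asboolP => -[].
- move=> u t v /asboolP[tu ut] /asboolP[uv vu]; apply/asboolP.
  by split; [apply: lle_trans uv|apply: lle_trans ut].
Qed.

Canonical lterm_equiv := EquivRelPack lterm_eqv_equiv.

Definition free_lattice : Type := {eq_quot lterm_equiv}.
HB.instance Definition _ := Choice.on free_lattice.
HB.instance Definition _ := EqQuotient.on free_lattice.

Implicit Types x y z : free_lattice.

Lemma lterm_repr (t : lterm X) :
  lterm_le (repr (\pi_free_lattice t)) t /\ lterm_le t (repr (\pi_free_lattice t)).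
Proof.
have /eqmodP/asboolP[] : repr (\pi_free_lattice t) = t %[mod free_lattice].
  by rewrite reprK.
by [].
Qed.

Definition free_le x y : bool := `[< lterm_le (repr x) (repr y) >].

Lemma free_le_refl : reflexive free_le.
Proof. by move=> x; apply/asboolP/lle_refl. Qed.

Lemma free_le_anti : antisymmetric free_le.
Proof.
move=> x y /andP[/asboolP xy /asboolP yx].
by rewrite -[x]reprK -[y]reprK; apply/eqmodP/asboolP.
Qed.

Lemma free_le_trans : transitive free_le.
Proof. by move=> y x z /asboolP xy /asboolP yz; apply/asboolP/(lle_trans xy). Qed.

Fact free_display : Order.disp_t. Proof. exact: Order.Disp tt tt. Qed.

HB.instance Definition _ := Order.Le_isPOrder.Build free_display free_lattice
  free_le_refl free_le_anti free_le_trans.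

Lemma le_pi (t u : lterm X) :
  reflect (lterm_le t u)
          ((\pi_free_lattice t : free_lattice) <= \pi_free_lattice u).
Proof.
have [[tl tr] [ul ur]] := (lterm_repr t, lterm_repr u).
apply: (iffP (asboolP _)) => tu.
  exact: lle_trans tr (lle_trans tu ul).
exact: lle_trans tl (lle_trans tu ur).
Qed.

Definition free_meet x y : free_lattice :=
  \pi_free_lattice (LMeet (repr x) (repr y)).
Definition free_join x y : free_lattice :=
  \pi_free_lattice (LJoin (repr x) (repr y)).

Lemma free_meetP x y z : (x <= free_meet y z) = (x <= y) && (x <= z).
Proof.
rewrite -[x]reprK -[y]reprK -[z]reprK.
set t := repr x; set u := repr y; set v := repr z.
apply/le_pi/andP => [tuv|[/le_pi tu /le_pi tv]]; last first.
  apply: lle_meet; [apply: lle_trans tu _|apply: lle_trans tv _];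
    exact: (lterm_repr _).2.
by split; apply/le_pi; apply: lle_trans tuv _;
  [apply: lle_trans (lle_meetl _ _) _|apply: lle_trans (lle_meetr _ _) _];
  apply: (lterm_repr _).1.
Qed.

Lemma free_joinP x y z : (free_join x y <= z) = (x <= z) && (y <= z).
Proof.
rewrite -[x]reprK -[y]reprK -[z]reprK.
set t := repr x; set u := repr y; set v := repr z.
apply/le_pi/andP => [tuv|[/le_pi tv /le_pi uv]]; last first.
  by apply: lle_join; [apply: lle_trans tv|apply: lle_trans uv];
    apply: (lterm_repr _).1.
by split; apply/le_pi; apply: lle_trans tuv;
  [apply: lle_trans (lle_joinl _ _)|apply: lle_trans (lle_joinr _ _)];
  apply: (lterm_repr _).2.
Qed.

HB.instance Definition _ :=
  Order.POrder_MeetJoin_isLattice.Build free_display free_lattice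
    free_meetP free_joinP.

Definition free_gen (i : X) : free_lattice := \pi_free_lattice (LVar i).

Lemma pi_meet (t u : lterm X) :
  \pi_free_lattice (LMeet t u) =
  (\pi_free_lattice t : free_lattice) `&` \pi_free_lattice u.
Proof.
apply: le_anti; rewrite lexI; apply/andP; split.
  by apply/andP; split; apply/le_pi; [apply: lle_meetl|apply: lle_meetr].
apply/le_pi; apply: lle_meet.
  exact: lle_trans (lle_meetl _ _) (lterm_repr _).1.
exact: lle_trans (lle_meetr _ _) (lterm_repr _).1.
Qed.

Lemma pi_join (t u : lterm X) :
  \pi_free_lattice (LJoin t u) =
  (\pi_free_lattice t : free_lattice) `|` \pi_free_lattice u.
Proof.
apply: le_anti; rewrite leUx; apply/and3P; split.
- apply/le_pi; apply: lle_join.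
    exact: lle_trans (lterm_repr _).2 (lle_joinl _ _).
  exact: lle_trans (lterm_repr _).2 (lle_joinr _ _).
- by apply/le_pi; apply: lle_joinl.
- by apply/le_pi; apply: lle_joinr.
Qed.

Lemma free_lattice_ind (P : free_lattice -> Prop) :
  (forall i, P (free_gen i)) ->
  (forall x y, P x -> P y -> P (x `&` y)) ->
  (forall x y, P x -> P y -> P (x `|` y)) ->
  forall x, P x.
Proof.
move=> Pgen Pmeet Pjoin x; rewrite -[x]reprK.
by elim: (repr x) => [i|t Pt u Pu|t Pt u Pu]; rewrite ?pi_meet ?pi_join;
  auto; apply: Pgen.
Qed.

Section Lift.
Context {d : Order.disp_t} {L : latticeType d} (f : X -> L).

Fixpoint lterm_eval (t : lterm X) : L :=
  match t with
  | LVar i => f i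
  | LMeet t u => lterm_eval t `&` lterm_eval u
  | LJoin t u => lterm_eval t `|` lterm_eval u
  end.

Lemma lterm_eval_le t u : lterm_le t u -> lterm_eval t <= lterm_eval u.
Proof.
elim=> {t u} /= [t|u t v _ tu _ uv|t u|t u|t u v _ tu _ tv|t u|t u|t u v _ tu _ uv];
  rewrite ?lexx ?leIl ?leIr ?leUl ?leUr ?lexI ?leUx ?tu ?tv ?uv //.
exact: le_trans tu uv.
Qed.

Definition free_lift (x : free_lattice) : L := lterm_eval (repr x).

Lemma free_lift_pi (t : lterm X) : free_lift (\pi_free_lattice t) = lterm_eval t.
Proof.
have [le1 le2] := lterm_repr t.
by apply: le_anti; rewrite !lterm_eval_le.
Qed.

End Lift.

(* Certifies that free_lattice X, with free_gen, is free among lattices. *)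
Theorem free_lattice_universal d (L : latticeType d) (f : X -> L) :
  exists! h : free_lattice -> L,
    [/\ {morph h : x y / x `&` y}, {morph h : x y / x `|` y}
      & forall i, h (free_gen i) = f i].
Proof.
exists (free_lift f); split=> [|h [hI hU hf]].
  split=> [x y|x y|i]; last exact: free_lift_pi.
    by rewrite -[x]reprK -[y]reprK -pi_meet !free_lift_pi.
  by rewrite -[x]reprK -[y]reprK -pi_join !free_lift_pi.
apply/funext => x; rewrite -[x]reprK free_lift_pi.
by elim: (repr x) => [i|t et u eu|t et u eu] /=;
  rewrite ?pi_meet ?pi_join ?hI ?hU ?et ?eu //; rewrite -hf.
Qed.

End FreeLattice.

(* A free lattice on finitely many generators has a zero, namely their meet. *)
Definition F3 : Type := free_lattice 'I_3.
HB.instance Definition _ := Order.Lattice.on F3.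

Definition F3_zero : F3 :=
  free_gen (inord 0 : 'I_3) `&` free_gen (inord 1 : 'I_3)
    `&` free_gen (inord 2 : 'I_3).

Lemma F3_zero_le (x : F3) : F3_zero <= x.
Proof.
elim/free_lattice_ind: x => [i|x y zx zy|x y zx _]; last 2 first.
- by rewrite lexI; apply/andP.
- exact: le_trans zx (leUl _ _).
rewrite -(inord_val i); case: i => [[|[|[|//]]] ?] /=.
- by rewrite /F3_zero -meetA leIl.
- by rewrite /F3_zero meetAC leIr.
- exact: leIr.
Qed.

HB.instance Definition _ := Order.hasBottom.Build free_display F3 F3_zero_le.

Section Tvee.
Context {d : Order.disp_t} (A : finTBLatticeType d).

Definition join_irreducibles : {set A} :=
  [set p : A | (p != \bot) &&
     [forall x : A, forall y : A, (p == x `|` y) ==> (p == x) || (p == y)]]%SET.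

(* X << Y *)
Definition refines (X Y : {set A}) : Prop :=
  forall x, x \in X -> exists2 y, y \in Y & x <= y.

Record minimal_pair (p : A) (I : {set A}) : Prop := MinimalPair {
  minimal_pair_irr : p \in join_irreducibles;
  minimal_pair_sub : I \subset join_irreducibles;
  minimal_pair_notin : p \notin I;
  minimal_pair_le : p <= \join_(i in I) i;
  minimal_pair_min : forall J : {set A}, J \subset join_irreducibles ->
    refines J I -> p <= \join_(j in J) j -> I \subset J
}.

Definition T_vee : Prop :=
  exists r : rel A,
    [/\ {in join_irreducibles &, antisymmetric r},
        {in join_irreducibles & &, transitive r},
        {in join_irreducibles &, total r}
      & forall (p : A) (J : {set A}), minimal_pair p J ->
          forall j, j \in J -> r p j].

End Tvee.

(* Main.v *)
(******************************************************************************)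
(* Two facts about minimal pairs (p, J) drive the proof: T_vee holds if and   *)
(* only if there is a rank rho with rho p < rho j for all j in J, and every   *)
(* join cover of p refines to a trivial one or to a minimal pair.             *)
(*                                                                            *)
(* If T_vee holds, recursion along the rank is available. Downwards, it       *)
(* computes, for a bi-ideal generated by finitely many (a_i, b_i), the        *)
(* largest beta p with (p, beta p) in the bi-ideal, so that A is amenable.    *)
(* Upwards, it chooses the values at the join-irreducibles of the embedding   *)
(* required by sharp transferability.                                         *)
(*                                                                            *)
(* Conversely, let T consist of the bounded N-valued level functions on A     *)
(* where a join loses at most one level. If xi : A -> T satisfies             *)
(* xi p <= join of xi(J) for all minimal pairs, and xi p has support below p  *)
(* with p in it, then the level of p in xi p is a rank. Transferability       *)
(* yields such a xi, as A embeds in Id T by a |-> {C | supp C <= a}. If       *)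
(* A (x) F(3) is a lattice, let (b_x), x in A, freely generate a sublattice   *)
(* of F(3). The sections at the join-irreducibles p of the bi-ideal generated *)
(* by the (x, b_x) are principal, that is, there is a largest term t_p with   *)
(* p <= t_p evaluated in the dual of A. Evaluating the t_p in the dual of T   *)
(* then yields xi.                                                            *)
(******************************************************************************)

Require Import Defs.
From HB Require Import structures.
From mathcomp Require Import all_boot all_order.
From mathcomp Require Import boolp classical_sets.

Set Implicit Arguments.
Unset Strict Implicit.
Unset Printing Implicit Defensive.

Import Order.Theory.

Local Open Scope classical_set_scope.
Local Open Scope order_scope.

(** * Whitman's condition and free families *)

(** Everything turns on one question: does recursion along minimal pairs terminate? For finite A
    this means that the relation from p to the elements of J, for minimal pairs (p, J), has no
    cycle, which is what [T_vee] says. Given this, [capped_of_rank] runs the recursion from J to p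
    and [transfer_of_rank] runs it from p to J. Conversely, levels count the steps of such a
    recursion: sharp transferability and the lattice property of A ⊗ F(3) both produce a family of
    levels, which [T_vee_of_levels] turns into a rank. For F(3), [F3_free_fintype] supplies a free
    family indexed by A. Inequalities between terms in that family are derivable from the lattice
    axioms, so they carry over to any lattice, in particular to the dual of the lattice of levels.
    [capped_is_lattice] closes the cycle. *)

Inductive whitman_le (X : Type) : lterm X -> lterm X -> Prop :=
| wle_var x : whitman_le (LVar x) (LVar x)
| wle_meetl t u v : whitman_le t v -> whitman_le (LMeet t u) v
| wle_meetr t u v : whitman_le u v -> whitman_le (LMeet t u) v
| wle_meet t u v : whitman_le t u -> whitman_le t v -> whitman_le t (LMeet u v)
| wle_joinl t u v : whitman_le t u -> whitman_le t (LJoin u v)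
| wle_joinr t u v : whitman_le t v -> whitman_le t (LJoin u v)
| wle_join t u v : whitman_le t v -> whitman_le u v -> whitman_le (LJoin t u) v.

Section Whitman.
Context {X : Type}.
Implicit Types t u v : lterm X.

Lemma whitman_le_refl t : whitman_le t t.
Proof.
elim: t => [x|t tt u uu|t tt u uu]; first exact: wle_var.
  by apply: wle_meet; [apply: wle_meetl|apply: wle_meetr].
by apply: wle_join; [apply: wle_joinl|apply: wle_joinr].
Qed.

(* Cut elimination. *)
Lemma whitman_le_trans u t v : whitman_le t u -> whitman_le u v -> whitman_le t v.
Proof.
elim: u t v => [x|u1 IH1 u2 IH2|u1 IH1 u2 IH2] t v.
- move eu: (LVar x) => u tu; elim: tu eu => // {t u}.
  + by move=> t w u _ IH eu /(IH eu); apply: wle_meetl.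
  + by move=> t w u _ IH eu /(IH eu); apply: wle_meetr.
  + by move=> t w u _ IHt _ IHw eu uv; apply: wle_join; [apply: IHt|apply: IHw].
- move eu: (LMeet u1 u2) => u tu; elim: tu eu => // {t u}.
  + by move=> t w u _ IH eu /(IH eu); apply: wle_meetl.
  + by move=> t w u _ IH eu /(IH eu); apply: wle_meetr.
  + move=> t w1 w2 tw1 _ tw2 _ [e1 e2]; rewrite -{}e1 -{}e2 in tw1 tw2 *.
    move eu: (LMeet u1 u2) => u uv; elim: uv eu => // {u v}.
    * by move=> a b v av _ [e1 e2]; apply: IH1 tw1 _; rewrite e1.
    * by move=> a b v bv _ [e1 e2]; apply: IH2 tw2 _; rewrite e2.
    * by move=> u v1 v2 _ IHv1 _ IHv2 eu; apply: wle_meet; [apply: IHv1|apply: IHv2].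
    * by move=> u v1 v2 _ IHv1 eu; apply: wle_joinl; apply: IHv1.
    * by move=> u v1 v2 _ IHv2 eu; apply: wle_joinr; apply: IHv2.
  + by move=> t w u _ IHt _ IHw eu uv; apply: wle_join; [apply: IHt|apply: IHw].
- move=> tu; move eu: (LJoin u1 u2) tu => u tu uv; elim: uv eu tu => // {u v}.
  + by move=> u v1 v2 _ IHv1 _ IHv2 eu tu; apply: wle_meet; [apply: IHv1|apply: IHv2].
  + by move=> u v1 v2 _ IHv1 eu tu; apply: wle_joinl; apply: IHv1.
  + by move=> u v1 v2 _ IHv2 eu tu; apply: wle_joinr; apply: IHv2.
  + move=> a b v av _ bv _ [e1 e2]; rewrite -{}e1 -{}e2 in av bv *.
    move eu: (LJoin u1 u2) => u tu; elim: tu eu => // {t u}.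
    * by move=> t w u _ IH eu; apply: wle_meetl; apply: IH.
    * by move=> t w u _ IH eu; apply: wle_meetr; apply: IH.
    * by move=> t c e tc _ [e1 e2]; apply: IH1 av; rewrite e1.
    * by move=> t c e te _ [e1 e2]; apply: IH2 bv; rewrite e2.
    * by move=> t w u _ IHt _ IHw eu; apply: wle_join; [apply: IHt|apply: IHw].
Qed.

Lemma lterm_le_whitman t u : lterm_le t u <-> whitman_le t u.
Proof.
split.
- elim=> {t u}.
  + exact: whitman_le_refl.
  + by move=> u t v _ tu _; apply: whitman_le_trans.
  + by move=> t u; apply/wle_meetl/whitman_le_refl.
  + by move=> t u; apply/wle_meetr/whitman_le_refl.
  + by move=> t u v _ tu _ tv; apply: wle_meet.
  + by move=> t u; apply/wle_joinl/whitman_le_refl.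
  + by move=> t u; apply/wle_joinr/whitman_le_refl.
  + by move=> t u v _ tv _ uv; apply: wle_join.
- elim=> {t u}.
  + by move=> x; apply: lle_refl.
  + by move=> t u v _; apply: lle_trans (lle_meetl _ _).
  + by move=> t u v _; apply: lle_trans (lle_meetr _ _).
  + by move=> t u v _ tu _ tv; apply: lle_meet.
  + by move=> t u v _ tu; apply: lle_trans tu (lle_joinl _ _).
  + by move=> t u v _ tu; apply: lle_trans tu (lle_joinr _ _).
  + by move=> t u v _ tv _ uv; apply: lle_join.
Qed.

(** A cut-free derivation of a meet below a join must end by taking apart one of the two terms,
    which leaves four alternatives. *)
Lemma lterm_le_meet_join t u v w :
  lterm_le (LMeet t u) (LJoin v w) ->
  [\/ lterm_le t (LJoin v w), lterm_le u (LJoin v w),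
      lterm_le (LMeet t u) v | lterm_le (LMeet t u) w].
Proof.
move/lterm_le_whitman => H; inversion H; subst.
- by constructor 1; apply/lterm_le_whitman.
- by constructor 2; apply/lterm_le_whitman.
- by constructor 3; apply/lterm_le_whitman.
- by constructor 4; apply/lterm_le_whitman.
Qed.

Fixpoint lterm_size t : nat :=
  match t with
  | LVar _ => 0
  | LMeet t u | LJoin t u => (lterm_size t + lterm_size u).+1
  end.

End Whitman.

(* Nested conditionals, not || and &&, keep call-by-value evaluation lazy.    *)
Fixpoint whitman_dec (X : eqType) (n : nat) (t u : lterm X) : bool :=
  if n isn't n'.+1 then false else
  if (match t, u with LVar x, LVar y => x == y | _, _ => false end) then true
  else if (match t with
    | LVar _ => false
    | LMeet t1 t2 => if whitman_dec n' t1 u then true else whitman_dec n' t2 u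
    | LJoin t1 t2 => if whitman_dec n' t1 u then whitman_dec n' t2 u else false
    end) then true
  else match u with
    | LVar _ => false
    | LMeet u1 u2 => if whitman_dec n' t u1 then whitman_dec n' t u2 else false
    | LJoin u1 u2 => if whitman_dec n' t u1 then true else whitman_dec n' t u2
    end.

(** The premises of a cut-free rule have smaller total size, so this fuel suffices. The
    contrapositive refutes [lterm_le] by computation. *)
Lemma lterm_le_dec (X : eqType) (t u : lterm X) :
  lterm_le t u -> whitman_dec (lterm_size t + lterm_size u).+1 t u.
Proof.
move/lterm_le_whitman => tu.
suff H n : (lterm_size t + lterm_size u < n)%N -> whitman_dec n t u by exact: H.
elim: tu n => {t u}.
- by move=> x [|n] //= _; rewrite eqxx.
- move=> t u v _ IH [|n] //=; rewrite ltnS => le_n.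
  by rewrite IH // (leq_trans _ le_n) // addSn ltnS leq_add2r leq_addr.
- move=> t u v _ IH [|n] //=; rewrite ltnS => le_n.
  rewrite (IH n); first by case: ifP; rewrite ?if_same.
  by rewrite (leq_trans _ le_n) // addSn ltnS leq_add2r leq_addl.
- move=> t u v _ IHu _ IHv [|n] //=; rewrite ltnS => le_n.
  rewrite IHu ?IHv ?if_same //; last first.
    by rewrite (leq_trans _ le_n) // addnS ltnS leq_add2l leq_addr.
  by rewrite (leq_trans _ le_n) // addnS ltnS leq_add2l leq_addl.
- move=> t u v _ IH [|n] //=; rewrite ltnS => le_n.
  by rewrite IH ?if_same // (leq_trans _ le_n) // addnS ltnS leq_add2l leq_addr.
- move=> t u v _ IH [|n] //=; rewrite ltnS => le_n.
  by rewrite (IH n) ?if_same // (leq_trans _ le_n) // addnS ltnS leq_add2l leq_addl.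
- move=> t u v _ IHt _ IHu [|n] //=; rewrite ltnS => le_n.
  rewrite IHt ?IHu //; last first.
    by rewrite (leq_trans _ le_n) // addSn ltnS leq_add2r leq_addr.
  by rewrite (leq_trans _ le_n) // addSn ltnS leq_add2r leq_addl.
Qed.

Lemma free_lattice_whitman X (a b c e : free_lattice X) :
  a `&` b <= c `|` e ->
  [\/ a <= c `|` e, b <= c `|` e, a `&` b <= c | a `&` b <= e].
Proof.
rewrite -[a]reprK -[b]reprK -[c]reprK -[e]reprK -pi_meet -pi_join.
move/le_pi/lterm_le_meet_join => [] H; [constructor 1|constructor 2|constructor 3|constructor 4];
  exact/le_pi.
Qed.

Lemma lterm_eval_gen X (t : lterm X) : lterm_eval (@free_gen X) t = \pi_(free_lattice X)%qT t.
Proof. by elim: t => //= t -> u ->; rewrite ?pi_meet ?pi_join. Qed.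

Lemma lterm_eval_morph X d (L : latticeType d) d' (L' : latticeType d')
    (h : L -> L') (f : X -> L) t :
  {morph h : x y / x `&` y} -> {morph h : x y / x `|` y} ->
  h (lterm_eval f t) = lterm_eval (h \o f) t.
Proof. by move=> hI hU; elim: t => //= t IHt u IHu; rewrite ?hI ?hU IHt IHu. Qed.

Definition free_family X d (L : latticeType d) (f : X -> L) : Prop :=
  forall t u, lterm_eval f t <= lterm_eval f u -> lterm_le t u.

Lemma free_gen_family X : free_family (@free_gen X).
Proof. by move=> t u; rewrite !lterm_eval_gen => /le_pi. Qed.

Fixpoint lterm_map X Y (j : X -> Y) (t : lterm X) : lterm Y :=
  match t with
  | LVar x => LVar (j x)
  | LMeet t u => LMeet (lterm_map j t) (lterm_map j u)
  | LJoin t u => LJoin (lterm_map j t) (lterm_map j u)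
  end.

Lemma lterm_eval_map X Y d (L : latticeType d) (j : X -> Y) (f : Y -> L) t :
  lterm_eval f (lterm_map j t) = lterm_eval (f \o j) t.
Proof. by elim: t => //= t -> u ->. Qed.

Lemma lterm_map_id X (t : lterm X) : lterm_map id t = t.
Proof. by elim: t => //= t -> u ->. Qed.

Lemma lterm_map_comp X Y Z (j : X -> Y) (k : Y -> Z) t :
  lterm_map k (lterm_map j t) = lterm_map (k \o j) t.
Proof. by elim: t => //= t -> u ->. Qed.

Lemma lterm_le_map X Y (j : X -> Y) t u :
  lterm_le t u -> lterm_le (lterm_map j t) (lterm_map j u).
Proof.
move=> /(lterm_eval_le (@free_gen Y \o j)).
by rewrite -2!(lterm_eval_map j) => /free_gen_family.
Qed.

Lemma free_family_cancel X Y d (L : latticeType d) (f : Y -> L) (j : X -> Y) (r : Y -> X) :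
  cancel j r -> free_family f -> free_family (f \o j).
Proof.
move=> jK ff t u; rewrite -2!(lterm_eval_map j) => /ff /(lterm_le_map r).
have rj : r \o j = id by apply/funext.
by rewrite !lterm_map_comp rj !lterm_map_id.
Qed.

(** A free family [e] embeds the free lattice on [Y] into [L]; evaluating representatives under [e]
    is this embedding. *)
Lemma free_family_comp X Y d (L : latticeType d) (e : Y -> L) (f : X -> free_lattice Y) :
  free_family e -> free_family f -> free_family (fun x => lterm_eval e (repr (f x))).
Proof.
move=> fe ff t u.
suff E v : lterm_eval (fun x => lterm_eval e (repr (f x))) v
    = lterm_eval e (repr (lterm_eval f v)).
  by rewrite !E => /fe tu; apply: ff; apply/asboolP.
have H w : lterm_eval e (repr (\pi_(free_lattice Y)%qT w)) = lterm_eval e w.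
  exact: free_lift_pi.
elim: v => //= v -> w ->.
  by rewrite -[in RHS](reprK (lterm_eval f v)) -[in RHS](reprK (lterm_eval f w)) -pi_meet H.
by rewrite -[in RHS](reprK (lterm_eval f v)) -[in RHS](reprK (lterm_eval f w)) -pi_join H.
Qed.

(* The ideal P_x witnesses that f x is not below a join of other values of f, *)
(* the filter Q_x that it is not above a meet of such.                        *)
Lemma independent_free_family X Y (f : X -> free_lattice Y) :
  (forall x, exists P : set (free_lattice Y),
     [/\ forall a b, a <= b -> P b -> P a, forall a b, P a -> P b -> P (a `|` b),
         ~ P (f x) & forall y, y <> x -> P (f y)]) ->
  (forall x, exists Q : set (free_lattice Y),
     [/\ forall a b, a <= b -> Q a -> Q b, forall a b, Q a -> Q b -> Q (a `&` b),
         ~ Q (f x) & forall y, y <> x -> Q (f y)]) ->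
  free_family f.
Proof.
move=> HP HQ.
have lev x u : f x <= lterm_eval f u -> lterm_le (LVar x) u.
  have [P [Pdn PU Px Pn]] := HP x.
  suff [//|Pu /Pdn /(_ Pu)//] : lterm_le (LVar x) u \/ P (lterm_eval f u).
  elim: u => [y|u1 [H1|H1] u2 [H2|H2]|u1 [H1|H1] u2 [H2|H2]] /=.
  - by have [->|/Pn] := pselect (y = x); [left; apply: lle_refl|right].
  - by left; apply: lle_meet.
  - by right; apply: Pdn H2; apply: leIr.
  - by right; apply: Pdn H1; apply: leIl.
  - by right; apply: Pdn H1; apply: leIl.
  - by left; apply: lle_trans H1 (lle_joinl _ _).
  - by left; apply: lle_trans H1 (lle_joinl _ _).
  - by left; apply: lle_trans H2 (lle_joinr _ _).
  - by right; apply: PU.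
have gev x u : lterm_eval f u <= f x -> lterm_le u (LVar x).
  have [Q [Qup QI Qx Qn]] := HQ x.
  suff [//|Qu /Qup /(_ Qu)//] : lterm_le u (LVar x) \/ Q (lterm_eval f u).
  elim: u => [y|u1 [H1|H1] u2 [H2|H2]|u1 [H1|H1] u2 [H2|H2]] /=.
  - by have [->|/Qn] := pselect (y = x); [left; apply: lle_refl|right].
  - by left; apply: lle_trans (lle_meetl _ _) H1.
  - by left; apply: lle_trans (lle_meetl _ _) H1.
  - by left; apply: lle_trans (lle_meetr _ _) H2.
  - by right; apply: QI.
  - by left; apply: lle_join.
  - by right; apply: Qup H2; apply: leUr.
  - by right; apply: Qup H1; apply: leUl.
  - by right; apply: Qup H1; apply: leUl.
elim=> [x u|t1 IH1 t2 IH2|t1 IH1 t2 IH2 u] /=; first exact: lev.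
- elim=> [x|u1 IHu1 u2 IHu2|u1 IHu1 u2 IHu2] /=; first exact: (gev x (LMeet t1 t2)).
  + by rewrite lexI => /andP[/IHu1 ? /IHu2 ?]; apply: lle_meet.
  (* Independence says nothing about a meet below a join; Whitman's condition in the ambient free
     lattice reduces this case to smaller terms. *)
  + case/free_lattice_whitman => [/(IH1 (LJoin u1 u2)) H|/(IH2 (LJoin u1 u2)) H|/IHu1 H|/IHu2 H].
    * exact: lle_trans (lle_meetl _ _) H.
    * exact: lle_trans (lle_meetr _ _) H.
    * exact: lle_trans H (lle_joinl _ _).
    * exact: lle_trans H (lle_joinr _ _).
- by rewrite leUx => /andP[/IH1 ? /IH2 ?]; apply: lle_join.
Qed.

(** * Free families in the free lattice on three generators *)

Section FourInThree.

Let X : lterm 'I_3 := LVar (@Ordinal 3 0 isT).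
Let Y : lterm 'I_3 := LVar (@Ordinal 3 1 isT).
Let Z : lterm 'I_3 := LVar (@Ordinal 3 2 isT).

(* Found by a computer search: none of these terms is below the join, or above *)
(* the meet, of the other three.                                              *)
Definition four_terms (i : nat) : lterm 'I_3 :=
  match i with
  | 0 => LMeet X (LJoin Y Z)
  | 1 => LJoin Y (LMeet X Z)
  | 2 => LMeet (LJoin X (LMeet Y Z)) (LJoin Z (LMeet X Y))
  | _ => LJoin (LMeet Y (LJoin X Z)) (LMeet Z (LJoin X Y))
  end.

Definition four_joins (i : nat) : lterm 'I_3 :=
  let g := four_terms in
  match i with
  | 0 => LJoin (g 1) (LJoin (g 2) (g 3))
  | 1 => LJoin (g 0) (LJoin (g 2) (g 3))
  | 2 => LJoin (g 0) (LJoin (g 1) (g 3))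
  | _ => LJoin (g 0) (LJoin (g 1) (g 2))
  end.

Definition four_meets (i : nat) : lterm 'I_3 :=
  let g := four_terms in
  match i with
  | 0 => LMeet (g 1) (LMeet (g 2) (g 3))
  | 1 => LMeet (g 0) (LMeet (g 2) (g 3))
  | 2 => LMeet (g 0) (LMeet (g 1) (g 3))
  | _ => LMeet (g 0) (LMeet (g 1) (g 2))
  end.

Lemma four_terms_not_le_joins i : (i < 4)%N -> ~ lterm_le (four_terms i) (four_joins i).
Proof. by case: i => [|[|[|[|//]]]] _ /lterm_le_dec; vm_compute. Qed.

Lemma four_meets_not_le_terms i : (i < 4)%N -> ~ lterm_le (four_meets i) (four_terms i).
Proof. by case: i => [|[|[|[|//]]]] _ /lterm_le_dec; vm_compute. Qed.

Lemma four_terms_le_joins i k : (i < 4)%N -> (k < 4)%N -> k <> i ->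
  lterm_le (four_terms k) (four_joins i).
Proof.
case: i => [|[|[|[|//]]]]; case: k => [|[|[|[|//]]]] //= _ _ _;
  first [exact: lle_joinl | apply: lle_trans (lle_joinr _ _);
         first [exact: lle_joinl|exact: lle_joinr]].
Qed.

Lemma four_meets_le_terms i k : (i < 4)%N -> (k < 4)%N -> k <> i ->
  lterm_le (four_meets i) (four_terms k).
Proof.
case: i => [|[|[|[|//]]]]; case: k => [|[|[|[|//]]]] //= _ _ _;
  first [exact: lle_meetl | apply: lle_trans (lle_meetr _ _) _;
         first [exact: lle_meetl|exact: lle_meetr]].
Qed.

End FourInThree.

Definition F3_one : F3 :=
  free_gen (inord 0 : 'I_3) `|` free_gen (inord 1 : 'I_3)
    `|` free_gen (inord 2 : 'I_3).

Lemma F3_le_one (x : F3) : x <= F3_one.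
Proof.
elim/free_lattice_ind: x => [i|x y zx _|x y zx zy]; last 2 first.
- exact: le_trans (leIl _ _) zx.
- by rewrite leUx; apply/andP.
rewrite -(inord_val i); case: i => [[|[|[|//]]] ?] /=.
- by rewrite /F3_one -joinA leUl.
- by rewrite /F3_one joinAC leUr.
- exact: leUr.
Qed.

(* The first three of the four terms replace the distinguished generators and *)
(* the fourth one stands for a new generator: this embeds F(n+1) into F(n)    *)
(* for n >= 3, and by iteration every F(n) into F(3).                         *)
Definition add_generator (Z : Type) (s : 'I_3 + option Z) : free_lattice ('I_3 + Z) :=
  let g i := lterm_eval (fun k => free_gen (inl k)) (four_terms i) in
  match s with
  | inl i => g i
  | inr None => g 3
  | inr (Some z) => free_gen (inr z)
  end.

Lemma add_generator_four Z (s : 'I_3 + option Z) :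
  (exists2 i, (i < 4)%N & [/\ add_generator s =
      lterm_eval (fun k => free_gen (inl k)) (four_terms i) &
      forall s' : 'I_3 + option Z, s' <> s ->
       (exists i', [/\ (i' < 4)%N, i' <> i & add_generator s' =
          lterm_eval (fun k => free_gen (inl k)) (four_terms i')]) \/
        exists z, add_generator s' = free_gen (inr z)]) \/
  exists2 z, add_generator s = free_gen (inr z) &
      forall s' : 'I_3 + option Z, s' <> s ->
       (exists i', add_generator s' =
          lterm_eval (fun k => free_gen (inl k)) (four_terms i')) \/
        exists2 z', add_generator s' = free_gen (inr z') & z' <> z.
Proof.
case: s => [i|[z|]]; [left|right|left].
- exists (val i); first exact: ltn_trans (ltn_ord i) _.
  split=> // -[i'|[z|]] ne; [left|right|left].
  + exists (val i'); split=> //; first exact: ltn_trans (ltn_ord i') _.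
    by move=> /val_inj e; apply: ne; rewrite e.
  + by exists z.
  + by exists 3; split=> //; move=> e; have := ltn_ord i; rewrite -e.
- exists z => // -[i'|[z'|]] ne; [left|right|left].
  + by exists (val i').
  + by exists z' => // e; apply: ne; rewrite e.
  + by exists 3.
- exists 3 => //; split=> // -[i'|[z|]] ne //; [left|right].
  + exists (val i'); split=> //; first exact: ltn_trans (ltn_ord i') _.
    by move=> e; have := ltn_ord i'; rewrite e.
  + by exists z.
Qed.

(** The separating ideals and filters are preimages under homomorphisms. For one of the four terms,
    the three generators are kept and the others collapse to the zero of F(3), or to its top for
    filters; the computed non-inequalities then apply. For another generator, a map to [bool]
    singles it out. *)
Lemma add_generator_free Z : free_family (@add_generator Z).
Proof.
have hE (h : free_lattice ('I_3 + Z) -> F3) i :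
    {morph h : x y / x `&` y} -> {morph h : x y / x `|` y} ->
    (forall k, h (free_gen (inl k)) = free_gen k) ->
    h (lterm_eval (fun k => free_gen (inl k)) (four_terms i))
    = \pi_(free_lattice 'I_3)%qT (four_terms i).
  move=> hI hU hg; rewrite (lterm_eval_morph _ _ hI hU) -lterm_eval_gen.
  by congr lterm_eval; apply/funext => k /=.
have bE (h : free_lattice ('I_3 + Z) -> bool) b i :
    {morph h : x y / x `&` y} -> {morph h : x y / x `|` y} ->
    (forall k, h (free_gen (inl k)) = b) ->
    h (lterm_eval (fun k => free_gen (inl k)) (four_terms i)) = b.
  move=> hI hU hg; rewrite (lterm_eval_morph _ _ hI hU).
  elim: (four_terms i) => [k|t /= -> u ->|t /= -> u ->] /=; [exact: hg| |];
    by case: b {hg}.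
apply: independent_free_family => s.
- have [[i i4 [-> sP]]|[z -> sP]] := add_generator_four s.
  + have [h [[hI hU hg] _]] := free_lattice_universal
      (fun k : 'I_3 + Z => if k is inl k' then free_gen k' else F3_zero : F3).
    exists [set u | h u <= \pi_(free_lattice 'I_3)%qT (four_joins i)]; split=> /=.
    * move=> a b ab; apply: le_trans.
      by rewrite -(join_r ab) hU leUl.
    * by move=> a b ha hb; rewrite hU leUx ha hb.
    * by rewrite hE // => /le_pi; apply: four_terms_not_le_joins.
    * move=> s' /sP[[i' [i'4 ne ->]]|[z ->]]; last by rewrite hg F3_zero_le.
      by rewrite hE //; apply/le_pi; apply: four_terms_le_joins.
  + have [h [[hI hU hg] _]] := free_lattice_universal
      (fun k : 'I_3 + Z => if k is inr z' then `[< z' = z >] else false).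
    exists [set u | h u = false]; split=> /=.
    * by move=> a b ab; rewrite -(join_r ab) hU; case: (h a).
    * by move=> a b ha hb; rewrite hU ha hb.
    * by rewrite hg asboolT //; discriminate.
    * move=> s' /sP[[i' ->]|[z' -> ne]]; last by rewrite hg asboolF.
      rewrite (bE _ false) // => k. by rewrite hg.
- have [[i i4 [-> sP]]|[z -> sP]] := add_generator_four s.
  + have [h [[hI hU hg] _]] := free_lattice_universal
      (fun k : 'I_3 + Z => if k is inl k' then free_gen k' else F3_one : F3).
    exists [set u | \pi_(free_lattice 'I_3)%qT (four_meets i) <= h u]; split=> /=.
    * move=> a b ab /le_trans; apply.
      by rewrite -(join_r ab) hU leUl.
    * by move=> a b ha hb; rewrite hI lexI ha hb.
    * by rewrite hE // => /le_pi; apply: four_meets_not_le_terms.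
    * move=> s' /sP[[i' [i'4 ne ->]]|[z ->]]; last by rewrite hg F3_le_one.
      by rewrite hE //; apply/le_pi; apply: four_meets_le_terms.
  + have [h [[hI hU hg] _]] := free_lattice_universal
      (fun k : 'I_3 + Z => if k is inr z' then ~~ `[< z' = z >] else true).
    exists [set u | h u]; split=> /=.
    * by move=> a b ab ha; rewrite -(join_r ab) hU ha.
    * by move=> a b ha hb; rewrite hI ha hb.
    * by rewrite hg asboolT.
    * move=> s' /sP[[i' ->]|[z' -> ne]]; last by rewrite hg asboolF.
      by rewrite (bE _ true) // => k; rewrite hg.
Qed.

(** The induction carries three distinguished members along, since each use of [add_generator]
    consumes and rebuilds them. *)
Lemma F3_free_ord n : exists f : 'I_3 + 'I_n -> F3, free_family f.
Proof.
elim: n => [|n [e fe]].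
  pose j (s : 'I_3 + 'I_0) : 'I_3 := if s is inl i then i else ord0.
  exists (@free_gen 'I_3 \o j).
  apply: (@free_family_cancel _ _ _ _ _ _ inl _ (@free_gen_family _)).
  by case=> // -[].
pose j (s : 'I_3 + 'I_n.+1) : 'I_3 + option 'I_n :=
  match s with inl i => inl i | inr k => inr (unlift ord0 k) end.
pose r (s : 'I_3 + option 'I_n) : 'I_3 + 'I_n.+1 :=
  match s with inl i => inl i | inr k => inr (oapp (lift ord0) ord0 k) end.
have jK : cancel j r.
  by case=> //= k; case: unliftP => [k'|] ->.
by eexists; apply: (free_family_cancel jK); apply: free_family_comp fe (@add_generator_free _).
Qed.

Theorem F3_free_fintype (T : finType) : exists f : T -> F3, free_family f.
Proof.
case: (posnP #|T|) => [T0|T_gt0].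
  exists (fun=> F3_zero) => t; have x : T by elim: t.
  by case: (fintype0 x).
have [e fe] := F3_free_ord #|T|.
pose r (s : 'I_3 + 'I_#|T|) : T := enum_val (if s is inr k then k else Ordinal T_gt0).
exists (e \o (inr \o enum_rank)); apply: (@free_family_cancel _ _ _ _ _ _ r _ fe).
by move=> x /=; rewrite /r /= enum_rankK.
Qed.

(** * Join-irreducibles and minimal pairs *)

Section JoinIrreducibles.
Context {d : Order.disp_t} {A : finTBLatticeType d}.
Implicit Types (p q a b x : A) (I J K U : {set A}).
Local Notation JI := (join_irreducibles A).

Lemma join_irr_neq0 p : p \in JI -> p != \bot.
Proof. by rewrite inE => /andP[]. Qed.

Lemma join_irrP p x y : p \in JI -> p = x `|` y -> p = x \/ p = y.
Proof.
rewrite inE => /andP[_ /forallP/(_ x)/forallP/(_ y)/implyP H] e.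
by have /orP[/eqP|/eqP] := H (introT eqP e); [left|right].
Qed.

Lemma join_irr_lt p x y : p \in JI -> x < p -> y < p -> x `|` y < p.
Proof.
move=> pJ xp yp; rewrite lt_neqAle leUx (ltW xp) (ltW yp) !andbT.
by apply/eqP => /esym/(join_irrP pJ)[e|e]; [rewrite e ltxx in xp|rewrite e ltxx in yp].
Qed.

Lemma join_irr_mem p (P : pred A) : p \in JI -> p = \join_(q | P q) q -> P p.
Proof.
move=> pJ e; apply/negPn/negP => nPp.
suff : \join_(q | P q) q < p by rewrite -e ltxx.
apply: (big_ind (fun x => x < p)) => [|x y|q Pq]; first by rewrite lt0x join_irr_neq0.
  exact: join_irr_lt.
rewrite lt_neqAle {2}e joins_sup // andbT.
by apply/eqP => qp; rewrite -qp Pq in nPp.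
Qed.

Lemma le_join_irr a : a <= \join_(p in JI | p <= a) p.
Proof.
have [n] := ubnP #|[pred x | x <= a]|; elim: n a => // n IHn a le_n.
have [->|a0] := eqVneq a \bot; first exact: le0x.
have [aJ|] := boolP (a \in JI); first by apply: joins_sup; rewrite aJ lexx.
rewrite inE a0 /= negb_forall => /existsP[x]; rewrite negb_forall => /existsP[y].
rewrite negb_imply => /andP[/eqP axy /norP[ax ay]].
have le_sub z : z <= a -> a != z -> z <= \join_(p in JI | p <= a) p.
  move=> za ne; apply: le_trans (IHn z _) _.
    rewrite ltnS in le_n; apply: leq_trans le_n; apply/proper_card/properP; split.
      by apply/fintype.subsetP => t; rewrite !inE => /le_trans; apply.
    exists a; rewrite !inE ?lexx //; apply: contra ne => az.
    by rewrite eq_le az za.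
  by apply/joinsP => p /andP[pJ pz]; apply: joins_sup; rewrite pJ (le_trans pz).
by rewrite [leLHS]axy leUx !le_sub // axy ?leUl ?leUr.
Qed.

Lemma not_le_join_irr a b : ~~ (a <= b) -> exists2 p, p \in JI & (p <= a) && ~~ (p <= b).
Proof.
move=> nab; apply: contrapT => H; move/negP: nab; apply.
apply: le_trans (le_join_irr a) _; apply/joinsP => p /andP[pJ pa].
by apply: contrapT => /negP npb; apply: H; exists p => //; rewrite pa.
Qed.

(** Among the down-closed sets of join-irreducibles whose join is above [p], choose a minimal one
    inside the down-set of [U]; its maximal elements form [J]. *)
Lemma minimal_pair_refine p U :
  p \in JI -> p <= \join_(u in U) u -> (forall u, u \in U -> ~~ (p <= u)) ->
  exists2 J, minimal_pair p J & refines J U.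
Proof.
move=> pJ pU npU.
pose down K := [set q in JI | [exists k in K, q <= k]]%SET.
pose Pr := [pred D : {set A} | [&& D \subset JI, down D \subset D & p <= \join_(q in D) q]].
have downP K q : reflect (q \in JI /\ exists2 k, k \in K & q <= k) (q \in down K).
  by apply: (iffP setIdP) => -[qJ /exists_inP].
have down_sub K : K \subset JI -> K \subset down K.
  move=> /fintype.subsetP KJ; apply/fintype.subsetP => k kK; apply/downP.
  by split; [apply: KJ|exists k].
have Pdown K : p <= \join_(q in K) q -> Pr (down K).
  move=> pK; apply/and3P; split.
  - by apply/fintype.subsetP => q /downP[].
  - apply/fintype.subsetP => q /downP[qJ [r /downP[_ [k kK rk]] qr]].
    by apply/downP; split=> //; exists k; rewrite // (le_trans qr).
  - apply: le_trans pK _; apply/joinsP => k kK.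
    apply: le_trans (le_join_irr k) _; apply/joinsP => q /andP[qJ qk].
    by apply: joins_sup; apply/downP; split=> //; exists k.
have [D minD sDU] := minset_exists (Pdown U pU).
have /and3P[DJ dD pD] := minsetp minD.
pose J := [set x in D | [forall y in D, (x <= y) ==> (x == y)]]%SET.
have JP x : reflect (x \in D /\ forall y, y \in D -> x <= y -> x = y) (x \in J).
  apply: (iffP setIdP) => -[xD H]; split=> //.
    by move=> y yD xy; have /implyP/(_ xy)/eqP := forall_inP H y yD.
  by apply/forall_inP => y yD; apply/implyP => xy; apply/eqP/H.
have sJD : J \subset D by apply/fintype.subsetP => x /JP[].
exists J; last first.
  move=> j /JP[jD _]; have /downP[_ [u uU ju]] := fintype.subsetP sDU j jD.
  by exists u.
split=> //.
- exact: fintype.subset_trans sJD DJ.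
- apply/negP => /JP[/(fintype.subsetP sDU)/downP[_ [u /npU/negP]]] //.
- apply: le_trans pD _; apply/joinsP => x xD.
  have x0 : (x \in D) && (x <= x) by rewrite xD lexx.
  case: (@arg_maxnP _ x (fun y => (y \in D) && (x <= y)) (fun y => #|[pred z | z <= y]|) x0) => m /andP[mD xm] maxm.
  apply: joins_min (xm); apply/JP; split=> // y yD my; apply: contrapT => ne.
  have := maxm y; rewrite yD (le_trans xm my) => /(_ isT).
  rewrite /= leqNgt => /negP; apply; apply/proper_card/properP; split.
    by apply/fintype.subsetP => t; rewrite !inE => /le_trans; apply.
  exists y; rewrite !inE ?lexx //; apply/negP => ym.
  by apply: ne; apply/eqP; rewrite eq_le my ym.
- move=> K KJ KrJ pK; apply/fintype.subsetP => j /JP[jD jmax].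
  (* By minimality [K] generates all of [D] as a down-set, so each maximal element of [D] must
     itself belong to [K]. *)
  have eD : down K = D.
    apply: minsetinf minD (Pdown K pK) _; apply/fintype.subsetP => q /downP[qJ [k /KrJ[j' j'J kj'] qk]].
    apply: (fintype.subsetP dD); apply/downP; split=> //.
    by exists j'; [apply: (fintype.subsetP sJD)|apply: le_trans kj'].
  move: (jD); rewrite -eD => /downP[_ [k kK jk]].
  rewrite (jmax k) // -eD; exact: (fintype.subsetP (down_sub K KJ)).
Qed.

Lemma minimal_pair_mem_irr p J j : minimal_pair p J -> j \in J -> j \in JI.
Proof. by move=> mp; apply: (fintype.subsetP (minimal_pair_sub mp)). Qed.

Lemma minimal_pair_neq0 p J : minimal_pair p J -> exists j, j \in J.
Proof.
move=> mp; apply: contrapT => H; have := minimal_pair_le mp.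
rewrite big1 ?lex0 ?(negbTE (join_irr_neq0 (minimal_pair_irr mp))) // => j jJ.
by case: H; exists j.
Qed.

Lemma T_vee_rank : T_vee A ->
  exists rho : A -> nat, forall p J, minimal_pair p J ->
    forall j, j \in J -> (rho p < rho j)%N.
Proof.
case=> r [anti tr tot rP]; exists (fun p => #|[pred x | (x \in JI) && r x p]|).
move=> p J mp j jJ; have pJ := minimal_pair_irr mp.
have jJI := minimal_pair_mem_irr mp jJ; have rpj := rP p J mp j jJ.
apply/proper_card/properP; split.
  apply/fintype.subsetP => x /andP[xJ rxp]; apply/andP; split=> //.
  exact: tr rpj.
exists j; first by apply/andP; split=> //; have := tot j j jJI jJI; rewrite orbb.
apply/negP => /andP[_ rjp]; have e : p = j by apply: anti => //; rewrite rpj.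
by move: (minimal_pair_notin mp); rewrite e jJ.
Qed.

(** The linear order is the order by rank, with ties broken by the enumeration of [A]. *)
Lemma rank_T_vee (rho : A -> nat) :
  (forall p J, minimal_pair p J -> forall j, j \in J -> (rho p < rho j)%N) -> T_vee A.
Proof.
move=> rhoP; exists (fun x y => (rho x < rho y)%N ||
  ((rho x == rho y) && (enum_rank x <= enum_rank y)%N)); split.
- move=> x y _ _ /andP[/orP[xy|/andP[/eqP xy rxy]] /orP[yx|/andP[/eqP yx ryx]]].
  + by have := ltn_trans xy yx; rewrite ltnn.
  + by rewrite yx ltnn in xy.
  + by rewrite xy ltnn in yx.
  + by apply/enum_rank_inj/val_inj/eqP; rewrite eqn_leq rxy.
- move=> y x z _ _ _ /orP[xy|/andP[/eqP-> rxy]] /orP[yz|/andP[/eqP<- ryz]].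
  + by rewrite (ltn_trans xy yz).
  + by rewrite xy.
  + by rewrite yz.
  + by rewrite eqxx (leq_trans rxy ryz) orbT.
- by move=> x y _ _; case: ltngtP => //= _; apply: leq_total.
- by move=> p J mp j jJ; rewrite (rhoP p J).
Qed.

End JoinIrreducibles.

(** Well-founded recursion by iteration: after n rounds, the values at points of rank below n no
    longer change. *)
Lemma rank_fixpoint (T : finType) (X : Type) (rho : T -> nat)
    (Phi : (T -> X) -> T -> X) (f0 : T -> X) :
  (forall f g p, (forall q, (rho q < rho p)%N -> f q = g q) -> Phi f p = Phi g p) ->
  exists f, forall p, f p = Phi f p.
Proof.
move=> PhiP.
have H n p : (rho p < n)%N -> iter n Phi f0 p = iter n.+1 Phi f0 p.
  elim: n p => // n IHn p; rewrite ltnS => le_n.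
  by rewrite !iterS; apply: PhiP => q lt_q; apply: IHn; apply: leq_trans le_n.
exists (iter (\max_p rho p).+1 Phi f0) => p.
by apply: H; rewrite ltnS (leq_bigmax p).
Qed.

(** * Capped tensor products *)

Section BigJoinIdx.
Context {d : Order.disp_t} {L : joinSemilatticeType d} {I : Type}.
Implicit Types (r : seq I) (P : pred I) (F : I -> L) (e z : L).

(** The default [e] counts as an extra operand, because a join-semilattice need not have a least
    element. *)
Lemma bigjoin_idx e r P F : e <= \big[Order.join/e]_(i <- r | P i) F i.
Proof. by elim/big_rec: _ => // i x _ ex; apply: le_trans ex (leUr _ _). Qed.

Lemma bigjoin_le e z r P F :
  e <= z -> (forall i, P i -> F i <= z) -> \big[Order.join/e]_(i <- r | P i) F i <= z.
Proof. by move=> ez Fz; elim/big_rec: _ => // i x Pi xz; rewrite leUx Fz. Qed.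

End BigJoinIdx.

Lemma bigjoin_sup d (L : joinSemilatticeType d) (I : eqType) (e : L) (r : seq I)
    (P : pred I) (F : I -> L) i :
  i \in r -> P i -> F i <= \big[Order.join/e]_(j <- r | P j) F j.
Proof.
move=> + Pi; elim: r => // j r IHr; rewrite inE big_cons => /predU1P[<-|/IHr Fi].
  by rewrite Pi leUl.
by case: ifP => // _; apply: le_trans Fi (leUr _ _).
Qed.

Section BigMeetIdx.
Context {d : Order.disp_t} {L : meetSemilatticeType d} {I : finType}.
Implicit Types (P : pred I) (F : I -> L) (e z : L).

Lemma bigmeet_idx e P F : \big[Order.meet/e]_(i | P i) F i <= e.
Proof. exact: (@bigjoin_idx _ L^d). Qed.

Lemma bigmeet_ge e z P F :
  z <= e -> (forall i, P i -> z <= F i) -> z <= \big[Order.meet/e]_(i | P i) F i.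
Proof. exact: (@bigjoin_le _ L^d). Qed.

Lemma bigmeet_inf e P F i : P i -> \big[Order.meet/e]_(j | P j) F j <= F i.
Proof. by move=> Pi; apply: (@bigjoin_sup _ L^d) => //; rewrite mem_index_enum. Qed.

End BigMeetIdx.

Section PureTensors.
Context {dA dB : Order.disp_t} {A : bLatticeType dA} {B : bLatticeType dB}.
Implicit Types (K : set (A * B)) (s : seq (A * B)).

Lemma biideal_botl K y : is_biideal K -> K (\bot, y).
Proof. by move=> bK; apply: (biideal_bot bK); right. Qed.

Lemma biideal_botr K x : is_biideal K -> K (x, \bot).
Proof. by move=> bK; apply: (biideal_bot bK); left. Qed.

Lemma biideal_le K a a' b b' :
  is_biideal K -> a <= a' -> b <= b' -> K (a', b') -> K (a, b).
Proof. by move=> bK aa' bb'; apply: (biideal_down bK). Qed.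

Lemma biideal_bigjoinl K (I : Type) (r : seq I) (P : pred I) (F : I -> A) y :
  is_biideal K -> (forall i, P i -> K (F i, y)) -> K (\join_(i <- r | P i) F i, y).
Proof.
move=> bK KF; elim/big_rec: _ => [|i x Pi Kx]; first exact: biideal_botl.
by apply: (biideal_joinl bK) => //; apply: KF.
Qed.

Lemma biideal_bigjoinr K (I : Type) (r : seq I) (P : pred I) (F : I -> B) x :
  is_biideal K -> (forall i, P i -> K (x, F i)) -> K (x, \join_(i <- r | P i) F i).
Proof.
move=> bK KF; elim/big_rec: _ => [|i y Pi Ky]; first exact: biideal_botr.
by apply: (biideal_joinr bK) => //; apply: KF.
Qed.

Lemma pure_set_sub K a b : is_biideal K -> K (a, b) -> pure_set a b `<=` K.
Proof.
by move=> bK Kab p [/(biideal_bot bK)//|[pa pb]]; apply: (biideal_down bK) Kab.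
Qed.

Lemma mem_join_pure s p : p \in s ->
  ((\join_(q <- s) pure_tensor q.1 q.2 : biideal A B) : set _) p.
Proof.
move=> ps; have := joins_sup_seq (fun q => pure_tensor q.1 q.2) ps (erefl true).
by rewrite le_biideal => /asboolP; apply; right.
Qed.

Lemma join_pure_sub s K : is_biideal K -> (forall p, p \in s -> K p) ->
  (\join_(q <- s) pure_tensor q.1 q.2 : biideal A B) `<=` K.
Proof.
move=> bK Ks; apply/asboolP.
change (\join_(q <- s) pure_tensor q.1 q.2 <= BiIdeal (asboolT bK)).
apply/joinsP_seq => -[a b] /Ks Kab _; rewrite le_biideal; apply/asboolP.
exact: pure_set_sub.
Qed.

Lemma tensor_gen (I : tensor A B) :
  exists s, (I : biideal A B) = \join_(q <- s) pure_tensor q.1 q.2.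
Proof. by case: I => I /= /asboolP. Qed.

Definition gen_tensor s : tensor A B :=
  Tensor (asboolT (ex_intro (fun r => \join_(q <- s) pure_tensor q.1 q.2
    = \join_(q <- r) pure_tensor q.1 q.2) s erefl)).

Lemma le_tensor (I J : tensor A B) : (I <= J) = `[< (I : set _) `<=` (J : set _) >].
Proof. by []. Qed.

Lemma le_tensorE (I J : tensor A B) : (I <= J) = ((I : biideal A B) <= J).
Proof. by []. Qed.

Lemma join_tensor_sup (I J : tensor A B) : supremums [set I; J] !=set0.
Proof.
have [[s sE] [r rE]] := (tensor_gen I, tensor_gen J).
have E : (gen_tensor (s ++ r) : biideal A B) = (I : biideal A B) `|` J.
  by rewrite sE rE /= big_cat.
exists (gen_tensor (s ++ r)); split.
  by move=> _ [->|->]; rewrite le_tensorE E ?leUl ?leUr.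
move=> M ubM; rewrite le_tensorE E leUx.
by apply/andP; split; apply: ubM; [left|right].
Qed.

(* Tensors that are finite unions of pure tensors are stable under           *)
(* intersection, as (a ⊗ b) ∩ (a' ⊗ b') = (a ∧ a') ⊗ (b ∧ b').              *)
Lemma capped_is_lattice : capped A B -> is_lattice (tensor A B).
Proof.
move=> cap I J; split; first exact: join_tensor_sup.
have [[s sE] [r rE]] := (cap I, cap J).
pose t := [seq (p.1 `&` q.1, p.2 `&` q.2) | p <- s, q <- r].
have tIJ : (gen_tensor t : set _) `<=` (I : set _) `&` (J : set _).
  apply: (join_pure_sub (setI_is_biideal I J)) => _ /allpairsP[[p q] /= [ps qr ->]].
  split; [rewrite sE; exists p|rewrite rE; exists q] => //; right;
    by split; rewrite /= ?leIl ?leIr.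
exists (gen_tensor t); split.
  by move=> _ [->|->]; rewrite le_tensor; apply/asboolP => x /tIJ[].
move=> M lbM; rewrite le_tensor; apply/asboolP => x Mx.
have bt := biidealP (gen_tensor t).
have : (I : set _) x.
  by have := lbM I (or_introl erefl); rewrite le_tensor => /asboolP; apply.
rewrite sE => -[p ps [/(biideal_bot bt)//|[x1 x2]]].
have : (J : set _) x.
  by have := lbM J (or_intror erefl); rewrite le_tensor => /asboolP; apply.
rewrite rE => -[q qr [/(biideal_bot bt)//|[y1 y2]]].
apply: (biideal_down bt) (_ : (gen_tensor t : set _) (p.1 `&` q.1, p.2 `&` q.2)).
- by rewrite /= lexI x1.
- by rewrite /= lexI x2.
- by apply: mem_join_pure; apply/allpairsP; exists (p, q).
Qed.

End PureTensors.

Section CappedOfRank.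
Context {d d' : Order.disp_t} {A : finTBLatticeType d} {B : bLatticeType d'}.
Context (rho : A -> nat).
Hypothesis rhoP : forall p J, minimal_pair p J -> forall j : A, j \in J -> (rho j < rho p)%N.
Context (s : seq (A * B)).
Local Notation JI := (join_irreducibles A).
(** Takes the place of the top that [B] need not have, as the default of meets. *)
Let m : B := \join_(i <- s) i.2.
Let I : set (A * B) := (\join_(q <- s) pure_tensor q.1 q.2 : biideal A B).

(* For p in J(A), beta p is the greatest y with (p, y) in I. *)
Let Phi (beta : A -> B) (p : A) : B :=
  (\join_(i <- s | p <= i.1) i.2) `|`
  \join_(J : {set A} | `[< minimal_pair p J >]) \big[Order.meet/m]_(j in J) beta j.

(** A pair (p, y) enters the bi-ideal through a generator, or through a minimal pair (p, J) with (j,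
    y) already present for all j in J; [Phi] records both. That nothing else enters holds because
    the pairs bounded by [beta] form a bi-ideal [K]. Hence the bi-ideal is the union of the finitely
    many a ⊗ [gamma] a. *)
Lemma capped_of_rank : exists t : seq (A * B),
  I = \bigcup_(p in [set` t]) pure_tensor p.1 p.2.
Proof.
have [beta betaE] : exists beta, forall p, beta p = Phi beta p.
  apply: (rank_fixpoint (rho := rho)) => [_|f g p fg]; first exact: m.
  congr (_ `|` _); apply: eq_bigr => J /asboolP mp; apply: eq_bigr => j jJ.
  exact/fg/(rhoP mp).
have sm i : i \in s -> i.2 <= m by move=> si; apply: (joins_sup_seq (fun i => i.2)).
have beta_m p : beta p <= m.
  rewrite betaE leUx; apply/andP; split.
    by apply/joinsP_seq => i si _; apply: sm.
  by apply/joinsP => J _; apply: bigmeet_idx.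
have beta_gen p i : i \in s -> p <= i.1 -> i.2 <= beta p.
  move=> si pi; rewrite betaE; apply: le_trans (leUl _ _).
  exact: (joins_sup_seq (fun i => i.2)).
have beta_mp p J y : minimal_pair p J -> y <= m -> (forall j, j \in J -> y <= beta j) ->
    y <= beta p.
  move=> mp ym yJ; rewrite betaE; apply: le_trans (leUr _ _).
  by apply: (@joins_min _ _ _ J); [apply/asboolP|apply: bigmeet_ge].
(* Minimal pairs of [q] need not be minimal pairs of [p], but each gives a cover of [p], which is
   trivial or refines to a minimal pair. *)
have beta_anti q p : p \in JI -> p <= q -> beta q <= beta p.
  have [n] := ubnP (rho q); elim: n q p => // n IHn q p; rewrite ltnS => le_n pJ pq.
  rewrite betaE leUx; apply/andP; split.
    apply/joinsP_seq => i si qi; apply: beta_gen => //; exact: le_trans qi.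
  apply/joinsP => J /asboolP mp.
  have IHj j r : j \in J -> r \in JI -> r <= j -> beta j <= beta r.
    by move=> jJ rJ rj; apply: IHn => //; apply: leq_trans le_n; apply: rhoP jJ.
  have [/exists_inP[j jJ pj]|/exists_inPn npJ] := boolP [exists j in J, p <= j].
    by apply: le_trans (IHj j p jJ pJ pj); apply: bigmeet_inf.
  have [J' mp' JJ'] := minimal_pair_refine pJ (le_trans pq (minimal_pair_le mp)) npJ.
  apply: (beta_mp _ _ _ mp'); first exact: bigmeet_idx.
  move=> j' j'J; have [j jJ jj'] := JJ' j' j'J.
  apply: le_trans (IHj j j' jJ (minimal_pair_mem_irr mp' j'J) jj').
  exact: bigmeet_inf.
have beta_cover p (U : pred A) y : p \in JI -> p <= \join_(u | U u) u ->
    (forall u q, U u -> q \in JI -> q <= u -> y <= beta q) -> y <= beta p.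
  move=> pJ pU yU.
  have [/existsP[u /andP[Uu pu]]|] := boolP [exists u, U u && (p <= u)].
    exact: yU pu.
  rewrite negb_exists => /forallP npU.
  have pU' : p <= \join_(u in [set u | U u]%SET) u.
    by under eq_bigl => u do rewrite inE.
  have npU' u : u \in [set u | U u]%SET -> ~~ (p <= u).
    by rewrite inE => Uu; have := npU u; rewrite Uu.
  have [J mp JU] := minimal_pair_refine pJ pU' npU'.
  have yJ j : j \in J -> y <= beta j.
    move=> jJ; have [u] := JU j jJ; rewrite inE => Uu ju.
    exact: yU Uu (minimal_pair_mem_irr mp jJ) ju.
  have [j jJ] := minimal_pair_neq0 mp.
  exact: beta_mp mp (le_trans (yJ j jJ) (beta_m j)) yJ.
have bI : is_biideal I by apply: biidealP.
have I_beta p : I (p, beta p).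
  have [n] := ubnP (rho p); elim: n p => // n IHn p; rewrite ltnS => le_n.
  rewrite betaE; apply: (biideal_joinr bI).
    rewrite big_seq_cond; apply: biideal_bigjoinr => // i /andP[si pi].
    by apply: (biideal_down bI) (mem_join_pure si).
  apply: biideal_bigjoinr => // J /asboolP mp.
  apply: (biideal_le bI (minimal_pair_le mp) (lexx _)).
  apply: biideal_bigjoinl => // j jJ.
  apply: (biideal_le bI (lexx _) _ (IHn j _)); first exact: bigmeet_inf.
  by apply: leq_trans le_n; apply: rhoP jJ.
pose K : set (A * B) := [set x | x.1 = \bot \/ x.2 = \bot \/
  forall p, p \in JI -> p <= x.1 -> x.2 <= beta p].
have bK : is_biideal K.
  split.
  - move=> [a b] [a' b'] /= aa' bb' [/= e|[/= e|/= H]].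
    + by left; apply/eqP; rewrite -lex0 -e.
    + by right; left; apply/eqP; rewrite -lex0 -e.
    + by right; right => p pJ pa; apply: le_trans bb' (H _ pJ (le_trans pa aa')).
  - by move=> p [[_ e]|[e _]]; [right; left|left].
  - move=> a y y' [/= e _|[/= -> K'|/= H]]; [by left|by rewrite join0x|].
    case=> [/= e|[/= ->|/= H']]; [by left|by rewrite joinx0; right; right|].
    by right; right=> p pJ pa /=; rewrite leUx H ?H'.
  - move=> a a' y [/= -> K'|[/= e _|/= H]]; [by rewrite join0x|by right; left|].
    case=> [/= ->|[/= e|/= H']]; [by rewrite joinx0; right; right|by right; left|].
    right; right=> p pJ pa /=.
    apply: (beta_cover p (fun u => (u == a) || (u == a')) y pJ).
      by apply: le_trans pa _; rewrite leUx; apply/andP; split;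
        apply: (joins_sup (fun u => u)); rewrite eqxx ?orbT.
    by move=> u q /orP[/eqP->|/eqP->]; [apply: H|apply: H'].
have IK : I `<=` K.
  apply: join_pure_sub => // i si; right; right => p pJ pi.
  exact: beta_gen.
pose gamma a : B := \big[Order.meet/m]_(p in JI | p <= a) beta p.
have I_gamma a : I (a, gamma a).
  apply: (biideal_le bI (le_join_irr a) (lexx _)).
  apply: biideal_bigjoinl => // p pa.
  apply: (biideal_le bI (lexx _) _ (I_beta p)).
  exact: (bigmeet_inf m (fun p => beta p) (i := p)).
exists [seq (a, gamma a) | a <- enum A]; apply/seteqP; split; last first.
  by move=> x [_ /mapP[a _ ->]]; apply: pure_set_sub.
move=> [a y] Iay; have inA x : (x, gamma x) \in [seq (a, gamma a) | a <- enum A].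
  by apply/mapP; exists x; rewrite ?mem_enum.
exists (a, gamma a); first exact: inA.
have [e|[e|H]] := IK _ Iay; [by left; right|by left; left|].
have [/= ->|a0] := eqVneq a \bot; first by left; right.
right; split=> //=; apply: bigmeet_ge => [|p /andP[]]; last exact: H.
(* A nonzero element has a join-irreducible below it, so the default [m] of the meet imposes no
   further bound on [y]. *)
have [p pJ /andP[pa _]] : exists2 p, p \in JI & (p <= a) && ~~ (p <= \bot).
  by apply: not_le_join_irr; rewrite lex0.
exact: le_trans (H p pJ pa) (beta_m p).
Qed.

End CappedOfRank.

Theorem T_vee_amenable d (A : finTBLatticeType d) : T_vee A -> amenable A.
Proof.
move=> /T_vee_rank[rho rhoP] d' L I; have [s ->] := tensor_gen I.
(* The rank grows from p to J whereas this recursion runs from J to p, so the rank is reversed. *)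
apply: (@capped_of_rank _ _ _ _ (fun x => \max_(p : A) rho p - rho x)%N).
move=> p J mp j jJ; have lt_pj := rhoP p J mp j jJ.
exact: ltn_sub2l (leq_trans lt_pj (leq_bigmax j)) lt_pj.
Qed.

(** * Lattices of levels *)

Section LevelLattice.
Context {d : Order.disp_t} (A : bLatticeType d).

(* (a, n) in C reads "a has height at least n"; a join may lose one level.    *)
Record is_level (C : set (A * nat)) : Prop := IsLevel {
  level_down : forall a b n, a <= b -> C (b, n) -> C (a, n);
  level_bot : forall n, C (\bot, n);
  level_join : forall a b n, C (a, n.+1) -> C (b, n.+1) -> C (a `|` b, n)
}.

(** Bounds leave room for the level lost in a join, which makes [level_ideal] preserve joins, and
    ensure that largest levels exist. *)
Definition level_bounded (C : set (A * nat)) : Prop :=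
  exists N, forall a n, C (a, n) -> a = \bot \/ (n < N)%N.

Record level := Level {
  level_set :> set (A * nat);
  _ : `[< is_level level_set /\ level_bounded level_set >]
}.

HB.instance Definition _ := [isSub for level_set].
HB.instance Definition _ := [Choice of level by <:].
HB.instance Definition _ :=
  [SubChoice_isSubPOrder of level by <: with set_display].

Implicit Types C D E : level.

Lemma levelP C : is_level C.
Proof. by case: C => C /= /asboolP[]. Qed.

Lemma level_boundedP C : level_bounded C.
Proof. by case: C => C /= /asboolP[]. Qed.

Lemma le_level C D : (C <= D) = `[< (C `<=` D)%classic >].
Proof. by []. Qed.

Lemma is_level_lt (N : nat) : is_level [set x | x.1 = \bot \/ (x.2 < N)%N].
Proof.
split=> /= [a b n ab [e|]|n|a b n [->|aN] [->|bN]].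
- by left; apply/eqP; rewrite -lex0 -e.
- by right.
- by left.
- by rewrite joinxx; left.
- by right; apply: ltnW.
- by right; apply: ltnW.
- by right; apply: ltnW.
Qed.

Lemma is_level_principal a : is_level [set x | x.1 <= a].
Proof.
by split=> /= [b c n|n|b c n ba ca]; [apply: le_trans|apply: le0x|rewrite leUx ba ca].
Qed.

Lemma is_levelI (C D : set (A * nat)) : is_level C -> is_level D -> is_level (C `&` D)%classic.
Proof.
move=> lC lD; split.
- by move=> a b n ab [Cb Db]; split;
    [apply: (level_down lC) Cb|apply: (level_down lD) Db].
- by move=> n; split; [apply: (level_bot lC)|apply: (level_bot lD)].
- by move=> a b n [Ca Da] [Cb Db]; split;
    [apply: (level_join lC)|apply: (level_join lD)].
Qed.

Lemma smallest_is_level (X : set (A * nat)) : is_level (smallest is_level X).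
Proof.
split.
- by move=> a b n ab Ib M sM; apply: (level_down sM.1 ab); apply: Ib.
- by move=> n M sM; apply: (level_bot sM.1).
- by move=> a b n Ia Ib M sM; apply: (level_join sM.1); [apply: Ia|apply: Ib].
Qed.

Lemma level_meet_subproof C D :
  `[< is_level (C `&` D)%classic /\ level_bounded (C `&` D)%classic >].
Proof.
apply/asboolP; split; first by apply: is_levelI; apply: levelP.
by have [N CN] := level_boundedP C; exists N => a n [/CN].
Qed.

Lemma level_join_subproof C D :
  `[< is_level (smallest is_level (C `|` D)%classic) /\
      level_bounded (smallest is_level (C `|` D)%classic) >].
Proof.
apply/asboolP; split; first exact: smallest_is_level.
have [N CN] := level_boundedP C; have [M DM] := level_boundedP D.
exists (maxn N M) => a n /(_ _ (conj (is_level_lt (maxn N M)) _)); apply.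
by move=> [b k] [/CN|/DM] [->|lt_k]; [left|right|left|right]; rewrite //= leq_max lt_k ?orbT.
Qed.

Definition meet_level C D : level := Level (level_meet_subproof C D).
Definition join_level C D : level := Level (level_join_subproof C D).

Lemma meet_levelP C D E : (C <= meet_level D E) = (C <= D) && (C <= E).
Proof. by rewrite !le_level -asbool_and; apply: asbool_equiv_eq; rewrite subsetI. Qed.

Lemma join_levelP C D E : (join_level C D <= E) = (C <= E) && (D <= E).
Proof.
rewrite !le_level -asbool_and; apply: asbool_equiv_eq; rewrite -subUset.
split=> sCDE; first exact: subset_trans (@sub_gen_smallest _ _ _) sCDE.
exact: smallest_sub (levelP E) sCDE.
Qed.

HB.instance Definition _ :=
  Order.POrder_MeetJoin_isLattice.Build set_display level
    meet_levelP join_levelP.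

Lemma level_joinE C D : (C `|` D : level) = smallest is_level (C `|` D)%classic :> set _.
Proof. by []. Qed.

Lemma level_pred C a n : (C : set _) (a, n.+1) -> (C : set _) (a, n).
Proof. by move=> Ca; rewrite -(joinxx a); apply: (level_join (levelP C)). Qed.

Lemma level0 C a n : (C : set _) (a, n) -> (C : set _) (a, 0%N).
Proof. by elim: n => // n IHn /level_pred. Qed.

Lemma level_principal_subproof a N :
  `[< is_level [set x : A * nat | x.1 = \bot \/ (x.1 <= a /\ (x.2 < N)%N)] /\
      level_bounded [set x : A * nat | x.1 = \bot \/ (x.1 <= a /\ (x.2 < N)%N)] >].
Proof.
apply/asboolP; split; last by exists N => b n [/= ->|[]]; [left|right].
have E : [set x : A * nat | x.1 = \bot \/ (x.1 <= a /\ (x.2 < N)%N)]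
    = ([set x | x.1 <= a] `&` [set x | x.1 = \bot \/ (x.2 < N)%N])%classic.
  apply/seteqP; split=> -[b n] /=; last by case=> ba [|]; [left|right].
  by case=> [/= e|[/= ba nN]]; split=> /=; rewrite ?e ?le0x //; [left|right].
by rewrite E; apply: is_levelI; [apply: is_level_principal|apply: is_level_lt].
Qed.

Definition level_principal a N : level := Level (level_principal_subproof a N).

End LevelLattice.

Section RankOfLevels.
Context {d : Order.disp_t} {A : finTBLatticeType d}.
Local Notation JI := (join_irreducibles A).

(* rho p is the largest n with (p, n) in xi p. If (p, J) is a minimal pair,   *)
(* q in J and a is the join of the join-irreducibles other than q refining J, *)
(* then a is not above p by minimality, and the level set equal to N below a, *)
(* rho q + 1 at q and rho q elsewhere majorizes xi on J, hence xi p.          *)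
Lemma T_vee_of_levels (xi : A -> level A) :
  (forall p, p \in JI -> (xi p : set _) (p, 0%N)) ->
  (forall p, p \in JI -> forall a n, (xi p : set _) (a, n) -> a <= p) ->
  (forall p J (C : level A), minimal_pair p J ->
     (forall j, j \in J -> xi j <= C) -> xi p <= C) ->
  T_vee A.
Proof.
move=> xi0 xi_supp xi_mp.
have [N NP] := choice (fun p => level_boundedP (xi p)).
have /choice[rho rhoP] p : exists k, p \in JI ->
    (xi p : set _) (p, k) /\ forall n, (xi p : set _) (p, n) -> (n <= k)%N.
  have [pJ|] := boolP (p \in JI); last by exists 0%N.
  have ex : exists n, `[< (xi p : set _) (p, n) >] by exists 0%N; apply/asboolP/xi0.
  have ub n : `[< (xi p : set _) (p, n) >] -> (n <= N p)%N.
    by move=> /asboolP/NP[/eqP|/ltnW//]; rewrite (negbTE (join_irr_neq0 pJ)).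
  have [k /asboolP Hk maxk] := ex_maxnP ex ub.
  by exists k => _; split=> // n /asboolP/maxk.
apply: (@rank_T_vee _ _ rho) => p J mp q qJ.
have pJI := minimal_pair_irr mp; have qJI := minimal_pair_mem_irr mp qJ.
pose U := [set x in JI | (x != q) && [exists j in J, x <= j]]%SET.
pose a := \join_(x in U) x.
have memU x j : x \in JI -> x != q -> j \in J -> x <= j -> x \in U.
  by move=> xJ xq jJ xj; apply/setIdP; split=> //; rewrite xq; apply/exists_inP; exists j.
have pa : ~~ (p <= a).
  apply/negP => pa; have sUJ : U \subset JI by apply/fintype.subsetP => x /setIdP[].
  have rUJ : refines U J by move=> x /setIdP[_ /andP[_ /exists_inP[j jJ xj]]]; exists j.
  have /fintype.subsetP/(_ q qJ)/setIdP[_] := minimal_pair_min mp sUJ rUJ pa.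
  by rewrite eqxx.
have JU j : j \in J -> j != q -> j \in U.
  by move=> jJ jq; apply: memU (minimal_pair_mem_irr mp jJ) jq jJ (lexx _).
have nqj j : j \in J -> j != q -> ~~ (q <= j).
  move=> jJ jq; apply/negP => qj; move/negP: pa; apply.
  apply: le_trans (minimal_pair_le mp) _; apply/joinsP => i iJ.
  have [->|iq] := eqVneq i q; last by apply: joins_sup; apply: JU.
  by apply: joins_min qj; apply: JU.
have lt_q x : x <= q -> x != q -> x <= a.
  move=> xq nxq; apply: le_trans (le_join_irr x) _; apply/joinsP => r /andP[rJ rx].
  apply: joins_sup; apply: (memU r q) => //; last exact: le_trans xq.
  by apply: contra nxq => /eqP e; rewrite eq_le xq -e.
pose M := (maxn (\max_(x : A) N x) (rho q).+1).
pose C : set (A * nat) := [set x | x.1 = \bot \/ (x.1 <= a /\ (x.2 < M)%N) \/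
  (x.1 = q /\ (x.2 <= rho q)%N) \/ (x.2 < rho q)%N].
have qM n : (n <= rho q)%N -> (n < M)%N by rewrite -ltnS leq_max orbC => ->.
have NM x n : (n < N x)%N -> (n < M)%N.
  by move=> nN; rewrite leq_max (leq_trans nN) // leq_bigmax.
have lC : is_level C.
  split.
  - move=> x y n xy [/= e|[/= [ya nM]|[/= [e nq]|/= nq]]].
    + by left; apply/eqP; rewrite -lex0 -e.
    + by right; left; split=> //; apply: le_trans ya.
    + have [xq|nxq] := eqVneq x q; first by right; right; left.
      by right; left; split; [apply: lt_q; rewrite // -e|apply: qM].
    + by right; right; right.
  - by left.
  - move=> x y n Cx Cy; have [nq|qn] := ltnP n (rho q); first by right; right; right.
    (* From level [rho q] on, the clauses about [q] and [rho q] cannot hold one level higher, so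
       both operands lie below [a]. *)
    have Ca z : C (z, n.+1) -> z = \bot \/ (z <= a /\ (n < M)%N).
      case=> [/= ->|[/= [za /ltnW nM]|[/= [_ nq]|/= nq]]]; [by left|by right|..].
        by move: (leq_trans nq qn); rewrite ltnn.
      by move: (leq_trans (ltnW nq) qn); rewrite ltnn.
    have [->|[xa nM]] := Ca x Cx; first rewrite join0x.
      by have [->|[ya nM]] := Ca y Cy; [left|right; left].
    right; left; split=> //=; rewrite leUx xa.
    by have [->|[]] := Ca y Cy; rewrite ?le0x.
have bC : level_bounded C.
  exists M => x n [/= ->|[/= [_ nM]|[/= [_ nq]|/= nq]]]; [by left|right..] => //.
    exact: qM.
  by apply: qM; apply: ltnW.
pose CL : level A := Level (asboolT (conj lC bC)).
have : xi p <= CL.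
  apply: xi_mp (mp) _ => j jJ; rewrite le_level; apply/asboolP => -[x n] xi_x.
  have xj := xi_supp j (minimal_pair_mem_irr mp jJ) x n xi_x.
  have [->|nN] := NP j x n xi_x; first by left.
  have [e|jq] := eqVneq j q; last first.
    right; left; split; last exact: NM nN.
    by apply: le_trans xj _; apply: joins_sup; apply: JU.
  rewrite e in xj xi_x nN; have [e'|xq] := eqVneq x q.
    by rewrite e' in xi_x; right; right; left; split=> //; apply: (rhoP q qJI).2.
  by right; left; split; [apply: lt_q|apply: NM nN].
(* At (p, rho p) only the last clause of [C] survives, and it is the desired inequality of ranks. *)
rewrite le_level => /asboolP/(_ _ (rhoP p pJI).1) [/= e|[/= [pa' _]|[/= [e _]|//]]].
- by have := join_irr_neq0 pJI; rewrite e eqxx.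
- by rewrite pa' in pa.
- by have := minimal_pair_notin mp; rewrite e qJ.
Qed.

End RankOfLevels.

(** * Sharp transferability *)

Lemma ideal_le_mem d (T : joinSemilatticeType d) (I J : ideal T) x :
  I <= J -> (I : set T) x -> (J : set T) x.
Proof. by rewrite le_ideal => /asboolP; apply. Qed.

Section LevelIdeals.
Context {d : Order.disp_t} (A : bLatticeType d).

Lemma level_ideal_subproof a :
  `[< is_ideal [set C : level A | forall x n, (C : set _) (x, n) -> x <= a] >].
Proof.
apply/asboolP; split.
- exists (level_principal \bot 0) => x n /= [->|[_]] //.
- by move=> C D; rewrite le_level => /asboolP CD Da x n /CD/Da.
- move=> C D Ca Da x n; rewrite level_joinE => /(_ _ (conj (is_level_principal a) _)); apply.
  by move=> [y k] [/Ca|/Da].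
Qed.

Definition level_ideal a : ideal (level A) := Ideal (level_ideal_subproof a).

(** For joins: if [C] is supported below the join of a and b and has all levels below N, then it
    lies under the join of the principal levels of height N + 1 at a and b, which loses only one
    level. *)
Lemma level_ideal_embedding : join_embedding level_ideal.
Proof.
have prin a : (level_ideal a : set _) (level_principal a 1).
  by move=> x n [/= ->|[]].
have inj a b : level_ideal a = level_ideal b -> a <= b.
  move=> e; have := prin a; rewrite e => /(_ a 0%N); apply.
  by right.
have mono a b : a <= b -> level_ideal a <= level_ideal b.
  move=> ab; rewrite le_ideal; apply/asboolP => C Ca x n /Ca xa; exact: le_trans ab.
split=> [a b e|a b]; first by apply: le_anti; rewrite !inj.
apply: le_anti; rewrite leUx !mono ?leUl ?leUr // !andbT le_ideal.
apply/asboolP => C Cab; have [N NP] := level_boundedP C.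
have bIJ := idealP (level_ideal a `|` level_ideal b).
apply: (ideal_down bIJ) (_ : C <= level_principal a N.+1 `|` level_principal b N.+1) _.
  rewrite le_level; apply/asboolP => -[x n] Cx; rewrite level_joinE => M [lM sM].
  have [->|nN] := NP x n Cx; first exact: level_bot.
  apply: (level_down lM (Cab x n Cx)).
  by apply: (level_join lM); apply: sM; [left|right]; right.
apply: (ideal_join bIJ).
  apply: (@ideal_le_mem _ _ (level_ideal a)); first exact: leUl.
  by move=> x n [/= ->|[]].
apply: (@ideal_le_mem _ _ (level_ideal b)); first exact: leUr.
by move=> x n [/= ->|[]].
Qed.

End LevelIdeals.

Theorem transferable_T_vee d (A : finTBLatticeType d) :
  sharply_transferable A -> T_vee A.
Proof.
move=> /(_ _ (level A) _ (level_ideal_embedding A))[xi [[_ xiU] xi_mem xi_le]].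
have xi_supp p a n : (xi p : set _) (a, n) -> a <= p by apply: xi_mem.
apply: (@T_vee_of_levels _ _ xi) => [p pJ|p _ a n|p J C mp JC].
(* Sharpness makes [p] the join of the support of [xi p], and a join-irreducible element belongs to
   any finite set whose join it is. *)
- apply/asboolP; apply: (join_irr_mem (P := fun x => `[< (xi p : set _) (x, 0%N) >]) pJ).
  apply: le_anti; apply/andP; split.
    by apply/xi_le => x n /level0 xi_x; apply: joins_sup; apply/asboolP.
  by apply/joinsP => x /asboolP/xi_supp.
- exact: xi_supp.
- have xi_mono x y : x <= y -> xi x <= xi y.
    by move=> xy; rewrite -(join_r xy) xiU leUl.
  apply: le_trans (xi_mono _ _ (minimal_pair_le mp)) _.
  (* The empty join is kept apart because [xi \bot] need not lie below [C]. *)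
  suff [e|//] : \join_(j in J) j = \bot \/ xi (\join_(j in J) j) <= C.
    move: (minimal_pair_le mp) (join_irr_neq0 (minimal_pair_irr mp)).
    by rewrite e lex0 => ->.
  elim/big_ind: _ => [|x y [->|xC] [->|yC]|j /JC ?]; [by left|..|by right].
  + by rewrite joinxx; left.
  + by rewrite join0x; right.
  + by rewrite joinx0; right.
  + by right; rewrite xiU leUx xC.
Qed.

Section TransferOfRank.
Context {d d' : Order.disp_t} {A : finTBLatticeType d} {T : joinSemilatticeType d'}.
Context (rho : A -> nat).
Hypothesis rhoP : forall p J, minimal_pair p J -> forall j : A, j \in J -> (rho p < rho j)%N.
Context (phi : A -> ideal T).
Hypothesis phi_emb : join_embedding phi.
Local Notation JI := (join_irreducibles A).

Lemma mem_join_ideal (I J : ideal T) t : ((I `|` J : ideal T) : set T) t ->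
  exists u v, [/\ (I : set T) u, (J : set T) v & t <= u `|` v].
Proof.
pose K : set T := [set t | exists u v, [/\ (I : set T) u, (J : set T) v & t <= u `|` v]].
have [[u0 Iu0] [v0 Jv0]] := (ideal_nonempty (idealP I), ideal_nonempty (idealP J)).
move=> /(_ K); apply; split.
  split; first by exists u0, u0, v0; rewrite leUl.
    by move=> x y xy [u [v [Iu Jv y_uv]]]; exists u, v; rewrite (le_trans xy).
  move=> x y [u [v [Iu Jv x_uv]]] [u' [v' [Iu' Jv' y_uv]]].
  exists (u `|` u'), (v `|` v'); split.
  - exact: (ideal_join (idealP I)).
  - exact: (ideal_join (idealP J)).
  - by rewrite joinACA leU2.
move=> x [Ix|Jx]; first by exists x, v0; rewrite leUl.
by exists u0, x; rewrite leUr.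
Qed.

Let phi_mono x y : x <= y -> phi x <= phi y.
Proof. by move=> xy; rewrite -(join_r xy) phi_emb.2 leUl. Qed.

Let phi_not_le x y : ~~ (x <= y) -> exists2 t, (phi x : set T) t & ~ (phi y : set T) t.
Proof.
move=> nxy; apply: contrapT => H; move/negP: nxy; apply.
have xy : phi x <= phi y.
  rewrite le_ideal; apply/asboolP => t xt; apply: contrapT => yt.
  by apply: H; exists t.
apply/join_idPl; apply: phi_emb.1; rewrite phi_emb.2.
exact/join_idPl.
Qed.

(** An element of a join of ideals splits into contributions from each of them. The one at [\bot]
    covers the empty join, as [T] need not have a least element. *)
Let split_join s t : (phi (\join_(j <- s) j) : set T) t ->
  exists y : A -> T, (forall j, (phi j : set T) (y j)) /\
    forall z, y \bot <= z -> (forall j, j \in s -> y j <= z) -> t <= z.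
Proof.
elim: s t => [|i s IHs] t.
  rewrite big_nil => t0; exists (fun=> t); split=> // j.
  exact: ideal_le_mem (phi_mono (le0x j)) t0.
rewrite big_cons phi_emb.2 => /mem_join_ideal[u [v [iu /IHs[y [yP vy]] t_uv]]].
exists (fun j => if j == i then y j `|` u else y j); split=> [j|z z0 zs].
  case: eqVneq => [->|_] //; exact: (ideal_join (idealP _)).
have le_y j : y j <= if j == i then y j `|` u else y j by case: ifP; rewrite ?leUl.
apply: le_trans t_uv _; rewrite leUx; apply/andP; split.
  by have := zs i (mem_head _ _); rewrite eqxx; apply: le_trans (leUr _ _).
apply: vy => [|j js]; first exact: le_trans z0.
by apply: le_trans (le_y j) (zs j _); rewrite inE js orbT.
Qed.

Let split_minimal_pair p J t : minimal_pair p J -> (phi p : set T) t ->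
  exists y : A -> T, (forall j, (phi j : set T) (y j)) /\
    forall z, (forall j, j \in J -> y j <= z) -> t <= z.
Proof.
move=> mp /(ideal_le_mem (phi_mono (minimal_pair_le mp))).
rewrite -big_enum => /split_join[y [yP ty]].
exists (fun j => y j `|` y \bot); split=> [j|z zJ].
  apply: (ideal_join (idealP _)) => //.
  exact: ideal_le_mem (phi_mono (le0x j)) (yP \bot).
have [i iJ] := minimal_pair_neq0 mp.
apply: ty => [|j]; first exact: le_trans (leUr _ _) (zJ i iJ).
by rewrite mem_enum => /zJ; apply: le_trans (leUl _ _).
Qed.

Let separating p : exists t, (phi p : set T) t /\
  forall y, ~~ (p <= y) -> ~ (phi y : set T) t.
Proof.
have [t0 pt0] := ideal_nonempty (idealP (phi p)).
have /choice[w wP] y : exists t, (phi p : set T) t /\ (~~ (p <= y) -> ~ (phi y : set T) t).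
  have [py|/phi_not_le[t pt yt]] := boolP (p <= y); first by exists t0.
  by exists t.
exists (\big[Order.join/t0]_(y : A | ~~ (p <= y)) w y); split=> [|y npy].
  elim/big_ind: _ => // [t u|y _]; first exact: (ideal_join (idealP _)).
  exact: (wP y).1.
move=> yt; apply: (wP y).2 => //; apply: (ideal_down (idealP _)) yt.
by apply: (bigjoin_sup _ w); rewrite // mem_index_enum.
Qed.

(** The map [xi] joins up values [eta p] at join-irreducibles. It is sharp since [eta p] dominates
    the separating element [eta0 p]. It preserves joins since [p] below the join of a and b is below
    one of them or refines them to a minimal pair (p, J), and then [eta p] lies below every common
    upper bound of the [eta j]. *)
Lemma transfer_of_rank : exists xi : A -> T,
  [/\ join_embedding xi, forall x, (phi x : set T) (xi x)
    & forall x y, (phi y : set T) (xi x) <-> x <= y].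
Proof.
have [eta0 eta0P] := choice separating.
(* Splittings are chosen in advance for every possible value of [eta p], so that the recursion
   becomes a function of the earlier values. *)
have /choice[Y YP] (x : A * {set A} * T) : exists y : A -> T,
    minimal_pair x.1.1 x.1.2 -> (phi x.1.1 : set T) x.2 ->
    (forall j, (phi j : set T) (y j)) /\
    forall z, (forall j, j \in x.1.2 -> y j <= z) -> x.2 <= z.
  have [[mp pt]|H] := pselect (minimal_pair x.1.1 x.1.2 /\ (phi x.1.1 : set T) x.2).
    by have [y yP] := split_minimal_pair mp pt; exists y.
  by exists eta0 => mp pt; case: H.
(* eta is chosen upwards along minimal pairs (p, J): once eta p is known, the *)
(* eta j with j in J are made large enough for their join to be above it.     *)
pose Phi (f : A -> T) j := \big[Order.join/eta0 j]_(x : A * {set A} |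
  `[< minimal_pair x.1 x.2 >] && (j \in x.2)) Y (x, f x.1) j.
have [eta etaE] : exists eta, forall p, eta p = Phi eta p.
  apply: (rank_fixpoint (rho := rho) eta0) => f g p fg.
  by apply: eq_bigr => x /andP[/asboolP mp px]; rewrite fg //; apply: rhoP mp _ px.
have eta_phi j : (phi j : set T) (eta j).
  have [n] := ubnP (rho j); elim: n j => // n IHn j; rewrite ltnS => le_n.
  rewrite etaE; apply: (big_ind (fun t => (phi j : set T) t)) => [|t u|x /andP[/asboolP mp jx]].
  - exact: (eta0P j).1.
  - exact: (ideal_join (idealP _)).
  - by apply: (YP (x, eta x.1) mp _).1; apply: IHn; apply: leq_trans le_n; apply: rhoP jx.
have eta_mp p J z : minimal_pair p J -> (forall j, j \in J -> eta j <= z) -> eta p <= z.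
  move=> mp zJ; apply: (YP (p, J, eta p) mp (eta_phi p)).2 => j jJ.
  apply: le_trans (zJ j jJ); rewrite [leRHS]etaE.
  apply: (bigjoin_sup _ (fun x => Y (x, eta x.1) j) (i := (p, J))) => /=.
    by rewrite mem_index_enum.
  by rewrite jJ andbT; apply/asboolP.
have eta_sep p y : ~~ (p <= y) -> ~ (phi y : set T) (eta p).
  move=> npy yp; apply: (eta0P p).2 npy _; apply: (ideal_down (idealP _)) yp.
  by rewrite etaE bigjoin_idx.
have [e e0] := ideal_nonempty (idealP (phi \bot)).
pose xi a := \big[Order.join/e]_(p | (p \in JI) && (p <= a)) eta p.
have eta_xi p a : p \in JI -> p <= a -> eta p <= xi a.
  move=> pJ pa; apply: (bigjoin_sup _ eta (i := p)); first by rewrite mem_index_enum.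
  by rewrite pJ.
have xi_phi a : (phi a : set T) (xi a).
  apply: (big_ind (fun t => (phi a : set T) t)) => [|t u|p /andP[_ pa]].
  - exact: ideal_le_mem (phi_mono (le0x a)) e0.
  - exact: (ideal_join (idealP _)).
  - exact: ideal_le_mem (phi_mono pa) (eta_phi p).
have xi_le x y : (phi y : set T) (xi x) <-> x <= y.
  split=> [xy|xy]; last exact: ideal_le_mem (phi_mono xy) (xi_phi x).
  apply: contrapT => /negP/not_le_join_irr[p pJ /andP[px npy]].
  by apply: eta_sep npy _; apply: (ideal_down (idealP _)) xy; apply: eta_xi.
have xi_mono a b : a <= b -> xi a <= xi b.
  move=> ab; apply: bigjoin_le => [|p /andP[pJ pa]]; first exact: bigjoin_idx.
  by apply: eta_xi => //; apply: le_trans ab.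
exists xi; split=> //; split=> [x y xy|a b].
  by apply: le_anti; apply/andP; split; apply/xi_le; rewrite ?xy // -xy.
apply: le_anti; rewrite leUx !xi_mono ?leUl ?leUr // !andbT.
apply: bigjoin_le => [|p /andP[pJ pab]].
  exact: le_trans (bigjoin_idx _ _ _ _) (leUl _ _).
have [pa|npa] := boolP (p <= a); first exact: le_trans (eta_xi _ _ pJ pa) (leUl _ _).
have [pb|npb] := boolP (p <= b); first exact: le_trans (eta_xi _ _ pJ pb) (leUr _ _).
have pU : p <= \join_(u in [set a; b]%SET) u.
  apply: le_trans pab _; rewrite leUx.
  by apply/andP; split; apply: (joins_sup (fun u => u)); rewrite !inE eqxx ?orbT.
have npU u : u \in [set a; b]%SET -> ~~ (p <= u).
  by rewrite !inE => /orP[/eqP->|/eqP->].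
have [J mp JU] := minimal_pair_refine pJ pU npU.
apply: eta_mp (mp) _ => j jJ; have jJI := minimal_pair_mem_irr mp jJ.
have [u] := JU j jJ; rewrite !inE => /orP[/eqP->|/eqP->] ju.
  exact: le_trans (eta_xi _ _ jJI ju) (leUl _ _).
exact: le_trans (eta_xi _ _ jJI ju) (leUr _ _).
Qed.

End TransferOfRank.

Theorem T_vee_transferable d (A : finTBLatticeType d) :
  T_vee A -> sharply_transferable A.
Proof.
move=> /T_vee_rank[rho rhoP] d' T phi phi_emb; exact: transfer_of_rank rhoP _ phi_emb.
Qed.

(** * Tensor products with the free lattice on three generators *)

(* The meet of I and p ⊗ m is generated by pure tensors a ⊗ b with a <= p, and *)
(* since p is join-irreducible only those with a = p contribute at p.        *)
Lemma is_lattice_section_max d d' (A : finTBLatticeType d) (B : bLatticeType d')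
    (I : tensor A B) (p : A) (m : B) :
  is_lattice (tensor A B) -> p \in join_irreducibles A ->
  exists y0, (I : set _) (p, y0) /\
    forall y, y <= m -> (I : set _) (p, y) -> y <= y0.
Proof.
move=> latAB pJ; have p0 := join_irr_neq0 pJ.
have [_ [M [lbM maxM]]] := latAB I (gen_tensor [:: (p, m)]).
have sub (N N' : tensor A B) : N <= N' -> (N : set _) `<=` (N' : set _).
  by rewrite le_tensor => /asboolP.
have MI := sub _ _ (lbM I (or_introl erefl)).
have MP x : (M : set _) x -> pure_set p m x.
  move=> /(sub _ _ (lbM _ (or_intror erefl))).
  apply: join_pure_sub (pure_set_is_biideal p m) _ x => q; rewrite inE => /eqP->.
  by right.
have memM y : y <= m -> (I : set _) (p, y) -> (M : set _) (p, y).
  move=> ym Ipy; have : gen_tensor [:: (p, y)] <= M.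
    apply: maxM => _ [->|->]; rewrite le_tensor; apply/asboolP => x.
      by apply: join_pure_sub (biidealP I) _ x => q; rewrite inE => /eqP->.
    apply: join_pure_sub (biidealP _) _ x => q; rewrite inE => /eqP->.
    apply: (biideal_le (biidealP _) (lexx p) ym).
    by apply: mem_join_pure; rewrite inE.
  by move=> /sub; apply; apply: mem_join_pure; rewrite inE.
have [s sE] := tensor_gen M; have bM := biidealP M.
have Ms q : q \in s -> (M : set _) q by rewrite sE; apply: mem_join_pure.
pose y0 := \join_(q <- s | q.1 == p) q.2.
exists y0; split.
  apply: MI; rewrite /y0 big_seq_cond; apply: biideal_bigjoinr => // -[a b] /=.
  by move=> /andP[qs /eqP <-]; apply: Ms.
move=> y ym /(memM y ym).
pose K : set (A * B) := [set x | x.2 = \bot \/ x.1 < p \/ (x.1 <= p /\ x.2 <= y0)].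
have bK : is_biideal K.
  split.
  - move=> [a b] [a' b'] /= aa' bb' [/= e|[/= ap|/= [ap b0]]].
    + by left; apply/eqP; rewrite -lex0 -e.
    + by right; left; apply: le_lt_trans ap.
    + by right; right; rewrite /= (le_trans aa') // (le_trans bb').
  - by move=> [a b] [[_ /= e]|[/= e _]]; [left|right; left; rewrite /= e lt0x].
  - move=> a b b' [/= ->|[/= ap|/= [ap b0]]]; [by rewrite join0x|by right; left|].
    case=> [/= ->|[/= ap'|/= [_ b0']]]; [|by right; left|].
      by rewrite joinx0; right; right.
    by right; right; rewrite /= leUx b0 b0'.
  - move=> a a' b [/= e|[/= ap|/= [ap b0]]]; [by left|..].
      case=> [/= e|[/= ap'|/= [ap' b0']]]; [by left|..].
        by right; left; apply: join_irr_lt.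
      by right; right; rewrite /= leUx (ltW ap) ap'.
    case=> [/= e|[/= ap'|/= [ap' b0']]]; [by left|..].
      by right; right; rewrite /= leUx (ltW ap') ap.
    by right; right; rewrite /= leUx ap' ap.
have MK : (M : set _) `<=` K.
  rewrite sE; apply: join_pure_sub => // -[a b] qs.
  have [[[_ /= e]|[/= e _]]|[/= ap bm]] := MP _ (Ms _ qs).
  - by left.
  - by right; left; rewrite /= e lt0x.
  - have [e|ne] := eqVneq a p; last by right; left; rewrite /= lt_neqAle ne.
    right; right; split=> //=.
    by apply: (joins_sup_seq (fun q => q.2) qs); apply/eqP.
move=> /MK[/= ->|[/=|[]//]]; first exact: le0x.
by rewrite ltxx.
Qed.

Fixpoint dual_eval d (A : latticeType d) (t : lterm A) : A :=
  match t with
  | LVar x => x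
  | LMeet t u => dual_eval t `|` dual_eval u
  | LJoin t u => dual_eval t `&` dual_eval u
  end.

Lemma dual_evalE d (A : latticeType d) (t : lterm A) :
  dual_eval t = lterm_eval (id : A -> A^d) t.
Proof. by elim: t => //= t -> u ->. Qed.

Lemma dual_eval_le d (A : latticeType d) (t u : lterm A) :
  lterm_le t u -> dual_eval u <= dual_eval t.
Proof. by rewrite !dual_evalE => /(lterm_eval_le (id : A -> A^d)). Qed.

Section TensorFreeFamily.
Context {d d' : Order.disp_t} {A : finTBLatticeType d} {B : bLatticeType d'}.
Context (f : A -> B).

Let I : tensor A B := gen_tensor [seq (x, f x) | x <- enum A].

(** A lateral join in one component needs a common value in the other, and the meet provides it;
    hence the dual operations in [A]. *)
Lemma tensor_dual_eval t : (I : set _) (dual_eval t, lterm_eval f t).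
Proof.
have bI := biidealP I; elim: t => [x|t It u Iu|t It u Iu] /=.
- by apply: mem_join_pure; apply/mapP; exists x; rewrite ?mem_enum.
- by apply: (biideal_joinl bI);
    [apply: biideal_le It|apply: biideal_le Iu]; rewrite ?leIl ?leIr.
- by apply: (biideal_joinr bI);
    [apply: biideal_le It|apply: biideal_le Iu]; rewrite ?leIl ?leIr.
Qed.

Lemma tensor_dual_eval_sub : (I : set _) `<=` [set x | x.1 = \bot \/ x.2 = \bot \/
  exists t, x.1 <= dual_eval t /\ x.2 <= lterm_eval f t].
Proof.
apply: join_pure_sub => [|_ /mapP[x _ ->]]; last by right; right; exists (LVar x).
split.
- move=> [a b] [a' b'] /= aa' bb' [/= e|[/= e|/= [t [at_ bt]]]].
  + by left; apply/eqP; rewrite -lex0 -e.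
  + by right; left; apply/eqP; rewrite -lex0 -e.
  + by right; right; exists t; rewrite (le_trans aa') // (le_trans bb').
- by move=> p [[_ e]|[e _]]; [right; left|left].
- move=> a b b' [/= e _|[/= -> Kb'|/= [t [at_ bt]]]]; [by left|by rewrite join0x|].
  case=> [/= e|[/= ->|/= [u [au bu]]]]; [by left|by rewrite joinx0; right; right; exists t|].
  right; right; exists (LJoin t u); split=> /=; first by rewrite lexI at_ au.
  exact: leU2.
- move=> a a' b [/= -> Ka'|[/= e _|/= [t [at_ bt]]]]; [by rewrite join0x|by right; left|].
  case=> [/= ->|[/= e|/= [u [au bu]]]]; [by rewrite joinx0; right; right; exists t|by right; left|].
  right; right; exists (LMeet t u); split=> /=; last by rewrite lexI bt bu.
  exact: leU2.
Qed.

(* In other words, dual_eval is a bounded homomorphism onto the dual of A.    *)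
Lemma is_lattice_greatest_term (p : A) : is_lattice (tensor A B) -> free_family f ->
  p \in join_irreducibles A ->
  exists t, p <= dual_eval t /\ forall u, p <= dual_eval u -> lterm_le u t.
Proof.
move=> latAB ff pJ; have p0 := join_irr_neq0 pJ.
(* This bound on all values of terms serves as the [m] of [is_lattice_section_max]. *)
have eval_max u : lterm_eval f u <= \join_(x : A) f x.
  elim: u => [x|u IHu v _|u IHu v IHv] /=; first exact: joins_sup.
    exact: le_trans (leIl _ _) IHu.
  by rewrite leUx IHu.
have [y [Iy maxy]] := is_lattice_section_max I (\join_(x : A) f x) latAB pJ.
have le_y u : p <= dual_eval u -> lterm_eval f u <= y.
  move=> pu; apply: maxy => //.
  exact: (biideal_le (biidealP I) pu (lexx _) (tensor_dual_eval u)).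
have [/= e|[/= e|/= [t [pt yt]]]] := tensor_dual_eval_sub Iy.
- by rewrite e eqxx in p0.
- exists (LVar p); split=> // u pu; apply: ff; apply: le_trans (le_y u pu) _.
  by rewrite e le0x.
- by exists t; split=> // u pu; apply: ff; apply: le_trans (le_y u pu) yt.
Qed.

End TensorFreeFamily.

Section LevelEval.
Context {d : Order.disp_t} {A : finTBLatticeType d} (N : nat).

Definition level_eval : lterm A -> level A :=
  @lterm_eval A _ (level A)^d (fun x => level_principal x N).

Lemma level_eval_le t u : lterm_le t u -> level_eval u <= level_eval t.
Proof. exact: (@lterm_eval_le A _ (level A)^d). Qed.

Lemma level_eval_supp t a n : (level_eval t : set _) (a, n) -> a <= dual_eval t.
Proof.
elim: t a n => [x|t IHt u IHu|t IHt u IHu] a n /=.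
- by move=> [/= ->|[]//]; apply: le0x.
- move=> /(_ [set x | x.1 <= dual_eval t `|` dual_eval u]); apply.
  split; first exact: is_level_principal.
  by move=> [b k] [/IHt|/IHu] /= ?; [apply: lexUl|apply: lexUr].
- by move=> [/IHt at_ /IHu au]; rewrite lexI at_ au.
Qed.

(** Each operation of [t] costs at most one level, so a start at height [N] beyond the size of [t]
    is enough. *)
Lemma level_eval_height t a n : a <= dual_eval t -> (n + lterm_size t < N)%N ->
  (level_eval t : set _) (a, n).
Proof.
elim: t a n => [x|t IHt u IHu|t IHt u IHu] a n /= at_ nN.
- by right; rewrite addn0 in nN.
- move=> M [lM sM]; apply: (level_down lM at_); apply: (level_join lM); apply: sM.
    left; apply: IHt => //; apply: leq_ltn_trans nN.
    by rewrite addSn -addnS leq_add2l ltnS leq_addr.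
  right; apply: IHu => //; apply: leq_ltn_trans nN.
  by rewrite addSn -addnS leq_add2l ltnS leq_addl.
- move: at_; rewrite lexI => /andP[at_ au]; split; [apply: IHt|apply: IHu] => //;
    apply: leq_ltn_trans nN; rewrite leq_add2l.
    exact: leqW (leq_addr _ _).
  exact: leqW (leq_addl _ _).
Qed.

End LevelEval.

(** The levels are the evaluations of the greatest terms t_p. For a minimal pair (p, J), the meet of
    the t_j evaluates above p in the dual of [A], so it is below t_p as a term, and [level_eval]
    reverses this inequality. *)
Theorem is_lattice_F3_T_vee d (A : finTBLatticeType d) :
  is_lattice (tensor A F3) -> T_vee A.
Proof.
move=> latA; have [f ff] := F3_free_fintype A.
have /choice[tm tmP] p : exists t, p \in join_irreducibles A ->
    p <= dual_eval t /\ forall u, p <= dual_eval u -> lterm_le u t.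
  have [pJ|_] := boolP (p \in join_irreducibles A); last by exists (LVar p).
  by have [t tP] := is_lattice_greatest_term latA ff pJ; exists t.
(* Exceeds the size of every chosen term, so that (p, 0) survives in the level of p. *)
pose N := (\max_(p : A) lterm_size (tm p)).+1.
apply: (@T_vee_of_levels _ _ (fun p => level_eval N (tm p))) => [p pJ|p pJ a n|p J C mp JC].
- by apply: level_eval_height (tmP p pJ).1 _; rewrite add0n ltnS (leq_bigmax p).
- move=> /level_eval_supp/le_trans; apply.
  exact: (dual_eval_le ((tmP p pJ).2 (LVar p) (lexx p))).
- have tmJ j : j \in J -> j <= dual_eval (tm j).
    by move=> jJ; apply: (tmP j (minimal_pair_mem_irr mp jJ)).1.
  have [[e _]|[t [pt tC]]] : (\join_(j in J) j = \bot /\ True) \/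
      exists t, \join_(j in J) j <= dual_eval t /\ level_eval N t <= C.
    elim/big_ind: _ => [|x y [[-> _]|[t [xt tC]]] [[-> _]|[u [yu uC]]]|j jJ].
    + by left.
    + by rewrite joinxx; left.
    + by rewrite join0x; right; exists u.
    + by rewrite joinx0; right; exists t.
    + right; exists (LMeet t u); split=> /=; first exact: leU2.
      change ((level_eval N t `|` level_eval N u : level A) <= C).
      by rewrite leUx tC uC.
    + by right; exists (tm j); split; [apply: tmJ|apply: JC].
  + have := minimal_pair_le mp.
    by rewrite e lex0 (negbTE (join_irr_neq0 (minimal_pair_irr mp))).
  + apply: le_trans tC; apply: level_eval_le.
    apply: (tmP p (minimal_pair_irr mp)).2.
    exact: le_trans (minimal_pair_le mp) pt.
Qed.

(* A finite lattice is nonempty, hence bounded. *)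
Theorem mainTheorem1 (d : Order.disp_t) (A : finTBLatticeType d) :
  [<-> amenable A;
       forall (d' : Order.disp_t) (B : bLatticeType d'), is_lattice (tensor A B);
       sharply_transferable A;
       is_lattice (tensor A F3);
       T_vee A].
Proof.
have amenable_lattice : amenable A ->
    forall (d' : Order.disp_t) (B : bLatticeType d'), is_lattice (tensor A B).
  by move=> amA d' B; apply: capped_is_lattice.
split; first exact: amenable_lattice.
split; first by move=> latA; apply/T_vee_transferable/is_lattice_F3_T_vee.
split; first by move=> /transferable_T_vee/T_vee_amenable/amenable_lattice.
split; first exact: is_lattice_F3_T_vee.
exact: T_vee_amenable.
Qed.
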